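(* Consider the single-component replacement model described in the context, with costs satisfying $0<c_p^{\mathrm{so}}<c_p^{\mathrm{uso}}<c_c$. Then the optimal long-run average cost policy is as follows. For state $2$: do nothing. For state $1$: replace at scheduled opportunities and at unscheduled opportunities occurring in $[t^*,\tau)$ (that is, at which the remaining time until the next scheduled opportunity lies in $[t^*,\tau)$), with $$t^*=\max\left\{0,\ \frac{1}{\mu_1+\mu_2}\ln\left(\frac{(\mu_1+\mu_2)c_p^{\mathrm{so}}-\mu_1c_c}{(\mu_1+\mu_2)c_p^{\mathrm{uso}}-\mu_1c_c}\right)\right\},$$ if $(\mu_1+\mu_2)c_p^{\mathrm{so}}<\mu_1c_c$, and do nothing otherwise.
   Context: Model. A single component has a fully observable, continuously monitored condition: state $2$ (perfect), state $1$ (satisfactory) or state $0$ (failed). It starts in state $2$. If not replaced, it spends an exponential time with rate $\mu_2$ in state $2$, then moves to state $1$, where it spends an exponential time with rate $\mu_1$, after which it fails. At failure it is instantaneously replaced by an as-good-as-new component (state $2$), at corrective cost $c_c$; hence the condition effectively evolves between states $1$ and $2$. Opportunities. Scheduled opportunities (SO) occur at the deterministic times $\tau,2\tau,3\tau,\dots$, with $\tau>0$. Unscheduled opportunities (USO) occur according to a Poisson process of rate $\lambda$, triggered by failures of other, unrelated components. The decision epochs are the SO and USO epochs; at each of them one chooses an action from $\{\text{replace},\text{do nothing}\}$. Replacing instantaneously puts an as-good-as-new component (state $2$) in place, at preventive cost $c_p^{\mathrm{so}}$ at an SO and $c_p^{\mathrm{uso}}$ at a USO. Doing nothing costs nothing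 and leaves the condition unchanged. Policies. The decision may depend on the current condition $i\in\{1,2\}$, on the type of opportunity (SO or USO), and on the remaining time $t\in[0,\tau)$ until the next scheduled opportunity (with $t=0$ at an SO). A policy is optimal if it minimises the long-run average cost per time unit.
   Formalization: When (μ1+μ2)c_p^so < μ1c_c ≤ (μ1+μ2)c_p^uso the formula for t* is undefined (logarithm of a negative number or division by zero); there t* is taken to be +∞, so that in state 1 one replaces at scheduled opportunities only. *)

(* Defs.v *)
From HB Require Import structures.
From mathcomp Require Import all_boot all_order all_algebra.
From mathcomp Require Import finmap.
From mathcomp Require Import all_classical all_reals all_analysis.

Set Implicit Arguments.
Unset Strict Implicit.
Unset Printing Implicit Defensive.

Import Order.TTheory GRing.Theory Num.Theory.
Import numFieldNormedType.Exports.

Local Open Scope classical_set_scope.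
Local Open Scope ring_scope.

Record params (R : realType) := Params {
  tau : R;     (* time between two scheduled opportunities *)
  lambda : R;  (* rate of the unscheduled opportunities *)
  mu1 : R;     (* rate of leaving the satisfactory state *)
  mu2 : R;     (* rate of leaving the perfect state *)
  c_so : R;
  c_uso : R;
  c_c : R }.

(* States 1 and 2; the failed state 0 is left instantaneously. *)
Inductive condition := Satisfactory | Perfect.
Inductive opportunity := SO | USO.
Inductive action := Replace | DoNothing.

(* The last argument is the remaining time until the next scheduled
   opportunity, which is 0 at a scheduled opportunity. *)
Definition policy (R : realType) := condition -> opportunity -> R -> action.

Definition measurable_policy (R : realType) (pi : policy R) : Prop :=
  forall i o, measurable [set t | pi i o t = Replace].

(* The number of the component in use and the number of past unscheduled
   opportunities only serve to select the next fresh random durations. *)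
Record config (R : realType) := Config {
  now : R;
  cond : condition;
  cond_end : R;   (* epoch at which the current sojourn in [cond] ends *)
  next_so : R;    (* epoch of the next scheduled opportunity *)
  next_uso : R;   (* epoch of the next unscheduled opportunity *)
  comp : nat;     (* components 0, 1, ..., [comp] have been in use *)
  uso : nat }.    (* number of past unscheduled opportunities *)

(* [life2 k] and [life1 k] are the sojourn times of component [k] in states 2
   and 1; [gap m] separates unscheduled opportunities [m] and [m.+1]
   ([gap 0] is the epoch of the first one). *)
Section trajectory.
Variables (R : realType) (p : params R) (pi : policy R).
Variables (life2 life1 gap : nat -> R).

Definition start : config R :=
  Config 0 Perfect (life2 0) (tau p) (gap 0) 0 0.

Definition renew (s : config R) : config R :=
  Config (now s) Perfect (now s + life2 (comp s).+1)
    (next_so s) (next_uso s) (comp s).+1 (uso s).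

Definition decide (a : action) (cost : R) (s : config R) : config R * R :=
  match a with
  | Replace => (renew s, cost)
  | DoNothing => (s, 0)
  end.

Definition end_sojourn (s : config R) : config R * R :=
  let x := cond_end s in
  match cond s with
  | Perfect =>
      (Config x Satisfactory (x + life1 (comp s))
         (next_so s) (next_uso s) (comp s) (uso s), 0)
  | Satisfactory =>
      (renew (Config x Satisfactory x
                (next_so s) (next_uso s) (comp s) (uso s)), c_c p)
  end.

Definition unscheduled (s : config R) : config R * R :=
  let x := next_uso s in
  decide (pi (cond s) USO (next_so s - x)) (c_uso p)
    (Config x (cond s) (cond_end s)
       (next_so s) (x + gap (uso s).+1) (comp s) (uso s).+1).

Definition scheduled (s : config R) : config R * R :=
  let x := next_so s in
  decide (pi (cond s) SO 0) (c_so p)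
    (Config x (cond s) (cond_end s)
       (x + tau p) (next_uso s) (comp s) (uso s)).

(* The configuration just after the next event, and the cost of that event.
   Simultaneous events have probability zero, so the order in which ties are
   resolved does not matter. *)
Definition step (s : config R) : config R * R :=
  if (cond_end s <= next_uso s) && (cond_end s <= next_so s) then end_sojourn s
  else if next_uso s <= next_so s then unscheduled s
  else scheduled s.

(* Just after the first [n] events. *)
Definition after (n : nat) : config R := iter n (fun s => (step s).1) start.

(* Total cost incurred in [0, h]. *)
Definition total_cost (h : R) : \bar R :=
  (\sum_(0 <= n <oo)
     (if (now (after n.+1) <= h)%R then (step (after n)).2%:E else 0))%E.

End trajectory.

Definition mutually_independent d (T : measurableType d) (R : realType)
    (P : probability T R) (I : choiceType) (X : I -> {mfun T >-> R}) : Prop :=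
  forall (J : {fset I}) (B : I -> set R), (forall i, measurable (B i)) ->
    P (\bigcap_(i in [set` J]) (X i @^-1` B i)) =
    (\prod_(i <- J) P (X i @^-1` B i))%E.

Definition exponential d (T : measurableType d) (R : realType)
    (P : probability T R) (rate : R) (X : {mfun T >-> R}) : Prop :=
  forall A : set R, measurable A -> distribution P X A = exponential_prob rate A.

(* [gap] consists of the interarrival times of the Poisson process of
   unscheduled opportunities. *)
Record driven_by d (T : measurableType d) (R : realType) (P : probability T R)
    (p : params R) (life2 life1 gap : nat -> {mfun T >-> R}) : Prop := DrivenBy {
  life2_exponential : forall k, exponential P (mu2 p) (life2 k);
  life1_exponential : forall k, exponential P (mu1 p) (life1 k);
  gap_exponential : forall m, exponential P (lambda p) (gap m);
  durations_independent :
    mutually_independent P (fun i : (nat + nat + nat)%type =>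
      match i with
      | inl (inl k) => life2 k
      | inl (inr k) => life1 k
      | inr m => gap m
      end) }.

Definition average_cost d (T : measurableType d) (R : realType)
    (P : probability T R) (p : params R)
    (life2 life1 gap : nat -> {mfun T >-> R}) (pi : policy R) : \bar R :=
  limf_esup (fun h : R =>
    (h^-1%:E * \int[P]_w total_cost p pi (life2 ^~ w) (life1 ^~ w) (gap ^~ w) h)%E)
    (+oo%R : set_system R).

Definition optimal d (T : measurableType d) (R : realType)
    (P : probability T R) (p : params R)
    (life2 life1 gap : nat -> {mfun T >-> R}) (pi : policy R) : Prop :=
  measurable_policy pi /\
  forall pi' : policy R, measurable_policy pi' ->
    (average_cost P p life2 life1 gap pi
       <= average_cost P p life2 life1 gap pi')%E.

(* When [(mu1 + mu2) c_so < mu1 c_c], the logarithm is meaningful only if also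
   [(mu1 + mu2) c_uso < mu1 c_c]. Otherwise no remaining time is long enough for
   replacing at an unscheduled opportunity to pay off, and the threshold is
   infinite. *)
Definition t_star (R : realType) (p : params R) : \bar R :=
  let m := mu1 p + mu2 p in
  if m * c_uso p < mu1 p * c_c p then
    (Num.max 0 (m^-1 * ln ((m * c_so p - mu1 p * c_c p) /
                           (m * c_uso p - mu1 p * c_c p))))%:E
  else +oo%E.

Definition control_limit_policy (R : realType) (p : params R) : policy R :=
  fun i o t =>
    match i, o with
    | Perfect, _ => DoNothing
    | Satisfactory, SO =>
        if (mu1 p + mu2 p) * c_so p < mu1 p * c_c p then Replace else DoNothing
    | Satisfactory, USO =>
        if ((mu1 p + mu2 p) * c_so p < mu1 p * c_c p)
           && ((t_star p <= t%:E)%E && (t < tau p))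
        then Replace else DoNothing
    end.

(* Main.v *)
Require Import Defs.
From HB Require Import structures.
From mathcomp Require Import all_boot all_order all_algebra.
From mathcomp Require Import finmap.
From mathcomp Require Import all_classical all_reals all_analysis.
From mathcomp Require Import measurable_realfun ring lra zify.

Set Implicit Arguments.
Unset Strict Implicit.
Unset Printing Implicit Defensive.

Import Order.TTheory GRing.Theory Num.Theory.
Import numFieldNormedType.Exports.

Local Open Scope classical_set_scope.
Local Open Scope ring_scope.

(** Why the policy is optimal.

    Write [V i s] for the relative cost of being in state [i] with remaining
    time [s] until the next scheduled opportunity, and let [D] be the extra cost
    of the satisfactory state, [V Satisfactory - V Perfect].  In a perfect state
    a replacement buys nothing.  In the satisfactory state it buys [D s], so it
    pays off exactly when [D s] exceeds the preventive cost; the optimality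
    equations therefore reduce to one scalar differential equation,
      D' = mu1 c_c - (mu1 + mu2) D - lambda max(0, D - c_uso),
    with D(0) = min(c_so, D(tau)).  It can be solved explicitly, since it is
    linear on either side of the level [c_uso]: [D] is constant if [c_so] is at
    least mu1 c_c / (mu1 + mu2), and otherwise it increases from [c_so] and
    crosses [c_uso] at the threshold [t_star], if at all ([wear_cost_exists]).
    Integrating V Perfect' = mu2 D - g, with [g] chosen such that V Perfect
    takes the same value at both ends of a period, gives [V] and the optimal
    average cost [g] ([gain]).

    That [g] is the optimal average cost is a verification argument.  For the
    total cost up to a horizon [H], truncated after [n] events, the function
    V + g (H - t) is an upper bound under the control limit policy
    ([mean_cost_le]), and, up to a bounded error, a lower bound under any policy
    ([mean_cost_ge]).  Both are inductions on [n] over the recursion [mean_costS],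
    which conditions on the first event.  The lower bound also has to
    show that the number of events before [H] is finite: an error term that
    decreases geometrically in [n] does this inside the same induction.
    Dividing by [H] leaves [g].

    The recursion has to be extracted from a trajectory that is a deterministic
    function of independent exponential durations.  This takes two steps.  First
    ([run_cost_same_mean]), the durations that a configuration has not yet used
    are independent of it, so that they can be integrated out one by one; the
    result is a recursion over configurations in which both clocks, the end of
    the sojourn and the next unscheduled opportunity, are known.  Second, if
    these clocks are exponential as well, then the loser of their race has an
    exponential residual time ([race]), so that the clocks can be forgotten. *)

(** * Exponential clocks *)

(** For functions of several clocks that are given by a formula. *)
Ltac measurability :=
  repeat first
    [ assumption
    | exact: measurable_id | exact: measurable_cst
    | exact: measurable_fst | exact: measurable_snd
    | apply: measurable_fun_pair
    | apply: measurable_and | apply: measurable_neg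
    | apply: measurable_fun_ler | apply: measurable_fun_ltr
    | apply: measurable_funB | apply: measurable_funD | apply: measurable_funM
    | apply: emeasurable_funD | apply: emeasurable_funM
    | apply: (measurableT_comp measurable_fst)
    | apply: (measurableT_comp measurable_snd)
    | apply: measurable_fun_ifT
    | match goal with H : measurable_fun setT ?f |- _ =>
        apply: (measurableT_comp H) end ].

Section density.
Local Open Scope ereal_scope.
Context d (T : measurableType d) (R : realType).
Variables (mu nu : {measure set T -> \bar R}) (g : T -> R).
Hypothesis g_ge0 : forall x, (0 <= g x)%R.
Hypothesis mg : measurable_fun setT g.
Hypothesis nuE : forall A, measurable A -> nu A = \int[mu]_(x in A) (g x)%:E.

Import HBNNSimple.

(** For indicator functions this is the hypothesis on [nu]; simple functions and
    monotone convergence do the rest. *)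
Lemma ge0_integral_density (f : T -> \bar R) :
  measurable_fun setT f -> (forall x, 0 <= f x) ->
  \int[nu]_x f x = \int[mu]_x (f x * (g x)%:E).
Proof.
move=> mf f0; pose f_ := nnsfun_approx measurableT mf.
have mgE : measurable_fun setT (EFin \o g) by exact/measurable_EFinP.
have cvf x : EFin \o f_^~ x @ \oo --> f x.
  by apply: cvg_nnsfun_approx => // ? _; exact: f0.
have ndf x m n : (m <= n)%N -> (f_ m x <= f_ n x)%R.
  by move=> mn; exact/lefP/nd_nnsfun_approx.
transitivity (limn (fun n => \int[nu]_x (f_ n x)%:E)).
  rewrite -monotone_convergence//=.
  - by apply: eq_integral => x _; apply/esym/cvg_lim => //; exact: cvf.
  - by move=> n; exact/measurable_EFinP.
  - by move=> n x _; rewrite lee_fin.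
  - by move=> x _ m n mn; rewrite lee_fin ndf.
transitivity (limn (fun n => \int[mu]_x ((f_ n x)%:E * (g x)%:E))); last first.
  rewrite -monotone_convergence//=.
  - apply: eq_integral => x _; apply/cvg_lim => //.
    by apply: cvgeZr => //; exact: cvf.
  - by move=> n; apply: emeasurable_funM => //; exact/measurable_EFinP.
  - by move=> n x _; rewrite mule_ge0 ?lee_fin.
  - by move=> x _ m n mn; rewrite lee_wpmul2r ?lee_fin ?ndf.
congr (limn _); apply/funext => n.
under eq_integral do rewrite fimfunE -fsumEFin//.
rewrite ge0_integral_fsum//; last 2 first.
- by move=> r; exact/measurable_EFinP/measurableT_comp.
- by move=> r x _; rewrite EFinM nnfun_muleindic_ge0.
under [RHS]eq_integral => x _.
  rewrite fimfunE -fsumEFin// ge0_mule_fsuml; last first.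
    by move=> r; rewrite EFinM nnfun_muleindic_ge0.
  over.
rewrite ge0_integral_fsum//; last 2 first.
- move=> r; apply: emeasurable_funM => //.
  exact/measurable_EFinP/measurableT_comp.
- by move=> r x _; rewrite mule_ge0 ?lee_fin// -lee_fin EFinM nnfun_muleindic_ge0.
apply: eq_fsbigr => r _.
rewrite integralZl_indic_nnsfun// integral_indic// setIT nuE//.
have mA : measurable (f_ n @^-1` [set r]) by [].
rewrite [\int[mu]_(x in _) _]integral_mkcond.
have [r0|r0] := leP 0%R r; last first.
  rewrite !integral0_eq ?mule0// => x _; rewrite ?patchE ?indicE preimage_nnfun0//.
    by rewrite in_set0 mulr0 mul0e.
  by rewrite in_set0.
rewrite -ge0_integralZl//; last 2 first.
- by apply/(measurable_restrictT _ mA)/measurable_funTS.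
- by move=> x _; rewrite patchE; case: ifP; rewrite ?lee_fin.
apply: eq_integral => x _; rewrite patchE indicE; case: ifPn => _.
  by rewrite mulr1.
by rewrite mulr0 mul0e mule0.
Qed.

End density.

Section lebesgue_shift.
Local Open Scope ereal_scope.
Context {R : realType}.
Notation mu := (@lebesgue_measure R).

Lemma measurable_shift (s : R) :
  measurable_fun [set: R] (fun x : R => x + s)%R.
Proof. by apply: measurable_funD. Qed.

Lemma lebesgue_measure_shift (s : R) (A : set R) : measurable A ->
  pushforward mu ((fun x => x + s)%R : _ -> measurableTypeR R) A = mu A.
Proof.
move=> mA; have ms := measurable_shift s.
apply/esym/lebesgue_measure_unique => //= _ [[a b]] _ <-.
rewrite /pushforward.
rewrite (_ : _ @^-1` _ = `](a - s)%R, (b - s)%R]%classic); last first.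
  by apply/seteqP; split => x /=; rewrite !in_itv/= ltrBlDr lerBrDr.
rewrite !lebesgue_measure_itv/= !lte_fin ltrD2r.
by case: ifP => // _; rewrite -!EFinB; congr EFin; ring.
Qed.

Lemma ge0_integral_shift (s : R) (f : R -> \bar R) :
  measurable_fun setT f -> (forall x, 0 <= f x) ->
  \int[mu]_x f (x + s)%R = \int[mu]_x f x.
Proof.
move=> mf f0; rewrite -[LHS]/(\int[mu]_(x in setT) (f \o (fun x => x + s)%R) x).
transitivity (\int[mu]_(x in ((fun x => x + s)%R : _ -> measurableTypeR R)
    @^-1` setT) (f \o (fun x => x + s)%R) x); first by rewrite preimage_setT.
rewrite -ge0_integral_pushforward//; last exact: measurable_shift.
apply: (@eq_measure_integral _ (measurableTypeR R)); first exact: measurable_shift.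
by move=> ? A mA _; exact: lebesgue_measure_shift.
Qed.

End lebesgue_shift.

Section exponential_clock.
Local Open Scope ereal_scope.
Context {R : realType}.
Notation mu := (@lebesgue_measure R).

(** A clock is any probability that agrees with the exponential one on the
    measurable sets, so that the distributions of the given durations qualify. *)
Definition exp_law (r : R) (nu : probability R R) : Prop :=
  forall A, measurable A -> nu A = exponential_prob r A.

Variables (r : R) (nu : probability R R).
Hypotheses (r_gt0 : (0 < r)%R) (nu_exp : exp_law r nu).

Lemma exp_integral_pdf (f : R -> \bar R) :
  measurable_fun setT f -> (forall x, 0 <= f x) ->
  \int[nu]_x f x = \int[mu]_x (f x * (exponential_pdf r x)%:E).
Proof.
move=> mf f0.
have mid : measurable_fun setT (idfun : R -> measurableTypeR R).
  by move=> _ A mA; rewrite setTI.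
transitivity (\int[pushforward nu (idfun : R -> measurableTypeR R)]_x f x).
  by rewrite ge0_integral_pushforward//= preimage_setT.
rewrite (@ge0_integral_density _ _ _ mu _ (exponential_pdf r))//.
- by move=> x; apply: exponential_pdf_ge0; exact: ltW.
- exact: measurable_exponential_pdf.
Qed.

Lemma exp_integral (f : R -> \bar R) :
  measurable_fun setT f -> (forall x, 0 <= f x) ->
  \int[nu]_x f x =
    \int[mu]_(x in `[0%R, +oo[) (f x * (r * expR (- r * x))%:E).
Proof.
move=> mf f0; rewrite exp_integral_pdf// [RHS]integral_mkcond.
apply: eq_integral => x _; rewrite patchE /exponential_pdf patchE.
by case: ifP => //; rewrite mule0.
Qed.

(** Shifting the integral by [s] multiplies the exponential density by the
    constant [expR (- r * s)]. Both the strict and the large comparison are needed,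
    because ties in a race are resolved in favour of one of the clocks. *)
Lemma memoryless (b : bool) (s : R) (f : R -> \bar R) : (0 <= s)%R ->
  measurable_fun setT f -> (forall x, 0 <= f x) ->
  \int[nu]_y (if (s < y ?<= if b)%R then f (y - s)%R else 0) =
    (expR (- r * s))%:E * \int[nu]_y f y.
Proof.
move=> s0 mf f0.
have ms : measurable_fun setT (fun y => (s < y ?<= if b)%R).
  by case: b => /=; [exact: measurable_fun_ler|exact: measurable_fun_ltr].
have mF : measurable_fun setT
    (fun y => if (s < y ?<= if b)%R then f (y - s)%R else 0).
  apply: measurable_fun_ifT => //.
  by apply: measurableT_comp => //; exact: measurable_funB.
rewrite exp_integral_pdf//; last by move=> x; case: ifP.
rewrite -(ge0_integral_shift s); last 2 first.
- by apply: emeasurable_funM => //; apply/measurable_EFinP; exact: measurable_exponential_pdf.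
- move=> x; rewrite mule_ge0//; first by case: ifP.
  by rewrite lee_fin exponential_pdf_ge0// ltW.
rewrite exp_integral//.
transitivity (\int[mu]_(x in `[0%R, +oo[)
  ((expR (- r * s))%:E * (f x * (r * expR (- r * x))%:E))); last first.
  rewrite ge0_integralZl//.
  - apply/measurable_funTS/emeasurable_funM => //; apply/measurable_EFinP.
    by apply: measurable_funM => //; apply: measurableT_comp => //; exact: measurable_funM.
  - by move=> x _; rewrite mule_ge0// lee_fin mulr_ge0 ?expR_ge0// ltW.
transitivity (\int[mu]_(x in [set` Interval (BSide b 0%R) (BInfty _ false)])
  ((expR (- r * s))%:E * (f x * (r * expR (- r * x))%:E))); last first.
  case: b {ms mF} => //; rewrite integral_itv_obnd_cbnd//.
  apply/measurable_funTS/emeasurable_funM => //; apply: emeasurable_funM => //.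
  apply/measurable_EFinP/measurable_funM => //.
  by apply: measurableT_comp => //; exact: measurable_funM.
rewrite [RHS]integral_mkcond; apply: eq_integral => x _.
rewrite patchE addrK.
have -> : (x \in [set` Interval (BSide b 0%R) +oo%O]) =
    (s < x + s ?<= if b)%R.
  rewrite mem_setE/= itv_boundlr/= andbT.
  by case: b {ms mF} => /=; rewrite bnd_simp ?lerDr ?ltrDr.
case: ifPn => [sx|_]; last by rewrite mul0e.
have x0 : (0 <= x)%R.
  by case: b {ms mF} sx => /=; rewrite ?lerDr ?ltrDr// => /ltW.
rewrite exponential_pdfE ?addr_ge0// mulrDr expRD muleCA -EFinM; congr (_ * _%:E).
ring.
Qed.

End exponential_clock.

Section race.
Local Open Scope ereal_scope.
Context {R : realType}.
Notation mu := (@lebesgue_measure R).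
Implicit Types (r l w : R) (nu : probability R R).

Lemma exp_integral_trunc r nu w (f : R -> \bar R) : (0 < r)%R -> exp_law r nu ->
  measurable_fun setT f -> (forall x, 0 <= f x) ->
  \int[nu]_x (if (x <= w)%R then f x else 0) =
    \int[mu]_(x in `[0%R, w]) (f x * (r * expR (- r * x))%:E).
Proof.
move=> r0 nuE mf f0; rewrite (exp_integral r0 nuE); last 2 first.
- by apply: measurable_fun_ifT => //; exact: measurable_fun_ler.
- by move=> x; case: ifP.
rewrite integral_mkcond [RHS]integral_mkcond; apply: eq_integral => x _.
rewrite !patchE !mem_setE /= !in_itv/= andbT.
by case: (0 <= x)%R => //=; case: ifP; rewrite ?mul0e.
Qed.

Lemma ge0_measurable_integral r nu (f : R * R -> \bar R) :
  measurable_fun setT f -> (forall z, 0 <= f z) ->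
  measurable_fun setT (fun x => \int[nu]_y f (x, y)).
Proof. by move=> mf f0; exact: (measurable_fun_fubini_tonelli_F f). Qed.

(** Once the time [x] of the first ring is fixed, the residual time of the other
    clock is again exponential by [memoryless]; surviving until [x] costs it the
    factor [expR (- l * x)], which is merged with the density of [x]. *)
Lemma race_left r l nu nu' (b : bool) w (f : R * R -> \bar R) :
  (0 < r)%R -> (0 < l)%R -> exp_law r nu -> exp_law l nu' ->
  measurable_fun setT f -> (forall z, 0 <= f z) ->
  \int[nu]_x \int[nu']_y
      (if (x < y ?<= if b)%R && (x <= w)%R then f (x, y - x)%R else 0) =
    \int[mu]_(x in `[0%R, w])
      ((expR (- (r + l) * x))%:E * (r%:E * \int[nu']_y f (x, y))).
Proof.
move=> r0 l0 nuE nuE' mf f0.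
have mb : measurable_fun setT (fun z : R * R => (z.1 < z.2 ?<= if b)%R).
  by case: b => /=; [exact: measurable_fun_ler|exact: measurable_fun_ltr].
have mg : measurable_fun setT (fun z : R * R =>
    if (z.1 < z.2 ?<= if b)%R then f (z.1, z.2 - z.1)%R else 0).
  by measurability.
transitivity (\int[nu]_x (if (x <= w)%R then
    \int[nu']_y (if (x < y ?<= if b)%R then f (x, y - x)%R else 0) else 0)).
  apply: eq_integral => x _; case: ifP => _.
    by apply: eq_integral => y _; rewrite andbT.
  by apply: integral0_eq => y _; rewrite andbF.
rewrite (exp_integral_trunc w r0 nuE)//; last 2 first.
- apply: (@ge0_measurable_integral r nu' _ mg) => z; by case: ifP.
- by move=> x; apply: integral_ge0 => y _; case: ifP.
apply: eq_integral => x /set_mem/=; rewrite in_itv/= => /andP[x0 _].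
rewrite (memoryless l0 nuE' b x0 (f := fun y => f (x, y)))//; last first.
  exact: measurableT_comp.
rewrite !EFinM opprD mulrDl expRD EFinM.
by rewrite [RHS]muleACA muleC (muleC r%:E).
Qed.

Lemma race_right r l nu nu' w (f : R * R -> \bar R) :
  (0 < r)%R -> (0 < l)%R -> exp_law r nu -> exp_law l nu' -> (0 <= w)%R ->
  measurable_fun setT f -> (forall z, 0 <= f z) ->
  \int[nu]_x \int[nu']_y
      (if (w < x)%R && (w < y)%R then f (x - w, y - w)%R else 0) =
    (expR (- (r + l) * w))%:E * \int[nu]_x \int[nu']_y f (x, y).
Proof.
move=> r0 l0 nuE nuE' w0 mf f0.
transitivity (\int[nu]_x (if (w < x)%R then
    (expR (- l * w))%:E * \int[nu']_y f (x - w, y)%R else 0)).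
  apply: eq_integral => x _; case: ifP => _; last by apply: integral0_eq.
  rewrite -(memoryless l0 nuE' false w0 (f := fun y => f (x - w, y)%R))//.
  exact: measurableT_comp.
have m1 := ge0_measurable_integral r nu' mf f0.
rewrite (memoryless r0 nuE false w0 (f := fun x =>
    (expR (- l * w))%:E * \int[nu']_y f (x, y))); last 2 first.
- exact: emeasurable_funM.
- by move=> x; rewrite mule_ge0 ?lee_fin ?expR_ge0// integral_ge0.
rewrite ge0_integralZl//; last by move=> x _; rewrite integral_ge0.
by rewrite muleA -EFinM -expRD; congr ((expR _)%:E * _); ring.
Qed.

(** Two independent clocks and the deadline [w]: [f] is evaluated if the first
    clock rings first, [g] if the second one does, and [h] if the deadline comes
    first. In each case the second argument of [f] and [g], and both arguments of
    [h], are residual times, which are fresh clocks by memorylessness. *)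
Lemma race r l nu nu' w (f g h : R * R -> \bar R) :
  (0 < r)%R -> (0 < l)%R -> exp_law r nu -> exp_law l nu' -> (0 <= w)%R ->
  measurable_fun setT f -> (forall z, 0 <= f z) ->
  measurable_fun setT g -> (forall z, 0 <= g z) ->
  measurable_fun setT h -> (forall z, 0 <= h z) ->
  \int[nu]_x \int[nu']_y
    (if (x <= y)%R && (x <= w)%R then f (x, y - x)%R
     else if (y <= w)%R then g (y, x - y)%R else h (x - w, y - w)%R) =
  \int[mu]_(x in `[0%R, w]) ((expR (- (r + l) * x))%:E *
     (r%:E * \int[nu']_y f (x, y) + l%:E * \int[nu]_y g (x, y))) +
  (expR (- (r + l) * w))%:E * \int[nu]_x \int[nu']_y h (x, y).
Proof.
move=> r0 l0 nuE nuE' w0 mf f0 mg g0 mh h0.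
pose F (z : R * R) :=
  if (z.1 <= z.2)%R && (z.1 <= w)%R then f (z.1, z.2 - z.1)%R else 0.
pose G (z : R * R) :=
  if (z.2 < z.1)%R && (z.2 <= w)%R then g (z.2, z.1 - z.2)%R else 0.
pose H (z : R * R) :=
  if (w < z.1)%R && (w < z.2)%R then h (z.1 - w, z.2 - w)%R else 0.
have mF : measurable_fun setT F by rewrite /F; measurability.
have mG : measurable_fun setT G by rewrite /G; measurability.
have mH : measurable_fun setT H by rewrite /H; measurability.
have F0 z : 0 <= F z by rewrite /F; case: ifP.
have G0 z : 0 <= G z by rewrite /G; case: ifP.
have H0 z : 0 <= H z by rewrite /H; case: ifP.
transitivity (\int[nu]_x \int[nu']_y (F (x, y) + G (x, y) + H (x, y))).
  apply: eq_integral => x _; apply: eq_integral => y _; rewrite /F/G/H/=.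
  case: (leP x y) => xy; case: (leP x w) => xw; case: (leP y w) => yw //=;
    rewrite ?adde0 ?add0e//; exfalso; lra.
transitivity (\int[nu]_x (\int[nu']_y F (x, y) + \int[nu']_y G (x, y) +
    \int[nu']_y H (x, y))).
  apply: eq_integral => x _.
  have mF1 : measurable_fun setT (fun y => F (x, y)) by exact: measurableT_comp.
  have mG1 : measurable_fun setT (fun y => G (x, y)) by exact: measurableT_comp.
  have mH1 : measurable_fun setT (fun y => H (x, y)) by exact: measurableT_comp.
  rewrite ge0_integralD//; last 2 first.
  - by move=> y _; rewrite adde_ge0.
  - exact: emeasurable_funD.
  by rewrite ge0_integralD.
have mF2 := ge0_measurable_integral r nu' mF F0.
have mG2 := ge0_measurable_integral r nu' mG G0.
have mH2 := ge0_measurable_integral r nu' mH H0.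
have F2 x : 0 <= \int[nu']_y F (x, y) by rewrite integral_ge0.
have G2 x : 0 <= \int[nu']_y G (x, y) by rewrite integral_ge0.
have H2 x : 0 <= \int[nu']_y H (x, y) by rewrite integral_ge0.
rewrite ge0_integralD//; last 2 first.
- by move=> y _; rewrite adde_ge0.
- exact: emeasurable_funD.
rewrite ge0_integralD//; congr (_ + _); last exact: race_right.
rewrite (race_left true w r0 l0 nuE nuE' mf f0).
rewrite (@fubini_tonelli _ _ _ _ _ nu nu' G)//.
have mI := ge0_measurable_integral r nu' mf f0.
have mJ := ge0_measurable_integral l nu mg g0.
have mexp k : measurable_fun [set: R] (fun x => (expR (- k * x))%:E).
  apply/measurable_EFinP; apply: measurableT_comp => //; exact: measurable_funM.
rewrite (race_left false w l0 r0 nuE' nuE mg g0) -ge0_integralD//; last 4 first.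
- by move=> x _; rewrite !mule_ge0 ?lee_fin ?expR_ge0 ?(ltW r0)// integral_ge0.
- apply/measurable_funTS/emeasurable_funM; [exact: mexp|].
  by apply: emeasurable_funM => //; exact: measurable_cst.
- by move=> x _; rewrite !mule_ge0 ?lee_fin ?expR_ge0 ?(ltW l0)// integral_ge0.
- apply/measurable_funTS/emeasurable_funM; [exact: mexp|].
  by apply: emeasurable_funM => //; exact: measurable_cst.
apply: eq_integral => x _; rewrite (addrC l) [RHS]ge0_muleDr//.
- by rewrite mule_ge0 ?lee_fin ?(ltW r0)// integral_ge0.
- by rewrite mule_ge0 ?lee_fin ?(ltW l0)// integral_ge0.
Qed.

End race.

(** * Independence of the unused durations *)

Section independence.
Local Open Scope ereal_scope.
Context d (T : measurableType d) (R : realType) (P : probability T R).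
Context (I : choiceType) (X : I -> {mfun T >-> R}).
Hypothesis X_indep : mutually_independent P X.

Definition cylinder (J : {fset I}) (B : I -> set R) : set T :=
  \bigcap_(i in [set` J]) (X i @^-1` B i).

(** Independence of [Y] from the [X i] with [i] in [F] is only required on
    cylinders: this is all that mutual independence provides directly, and it
    determines the joint law with each further [X j]. *)
Definition indep_of dE (E : measurableType dE) (Y : T -> E) (F : set I) : Prop :=
  measurable_fun setT Y /\
  forall S (J : {fset I}) (B : I -> set R), measurable S ->
    (forall i, measurable (B i)) -> [set` J] `<=` F ->
    P (Y @^-1` S `&` cylinder J B) = P (Y @^-1` S) * P (cylinder J B).

Lemma measurable_cylinder J B : (forall i, measurable (B i)) ->
  measurable (cylinder J B).
Proof.
move=> mB; rewrite /cylinder.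
apply: fin_bigcap_measurable => // i _; rewrite -[X in measurable X]setTI.
exact: measurable_funPT.
Qed.

Lemma cylinderE J B : (forall i, measurable (B i)) ->
  P (cylinder J B) = \prod_(i <- J) P (X i @^-1` B i).
Proof. exact: X_indep. Qed.

Lemma cylinder0 B : cylinder fset0 B = setT.
Proof. by rewrite /cylinder; apply/seteqP; split => // w _ i. Qed.

Definition update (B : I -> set R) (j : I) (A : set R) (i : I) : set R :=
  if i == j then A else B i.

Lemma measurable_update B j A : (forall i, measurable (B i)) -> measurable A ->
  forall i, measurable (update B j A i).
Proof. by move=> mB mA i; rewrite /update; case: ifP. Qed.

Lemma cylinderU1 (J : {fset I}) B j A : j \notin J ->
  cylinder (j |` J)%fset (update B j A) = X j @^-1` A `&` cylinder J B.
Proof.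
move=> jJ; apply/seteqP; split => w.
  move=> H; split; first by have := H j; rewrite /update/= eqxx; apply; rewrite !inE eqxx.
  move=> i /= iJ; have := H i; rewrite /update/=; case: eqP => [ij|_].
    by rewrite -ij iJ in jJ.
  by apply; rewrite !inE iJ orbT.
move=> [HA HB] i /=; rewrite /update !inE; case: eqP => [-> _//|_ /= iJ].
exact: HB.
Qed.

Lemma cylinderU1_prob (J : {fset I}) B j A : j \notin J ->
  (forall i, measurable (B i)) -> measurable A ->
  P (X j @^-1` A `&` cylinder J B) = P (X j @^-1` A) * P (cylinder J B).
Proof.
move=> jJ mB mA; rewrite -cylinderU1// cylinderE; last exact: measurable_update.
rewrite big_fsetU1//= {1}/update eqxx cylinderE//; congr (_ * _).
apply: eq_big_seq => i iJ; rewrite /update; case: eqP => // ij.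
by rewrite -ij iJ in jJ.
Qed.

Lemma indep_of_cst dE (E : measurableType dE) (e : E) F :
  indep_of (cst e) F.
Proof.
split=> // S J B mS mB _; rewrite preimage_cst; case: ifP => _.
  by rewrite setTI probability_setT mul1e.
by rewrite set0I measure0 mul0e.
Qed.

Section extension.
Context dE (E : measurableType dE) (Y : T -> E) (F : set I) (j : I).
Hypotheses (YF : indep_of Y F) (Fj : F j).

Let mY : measurable_fun setT Y := proj1 YF.
Let Ym : {mfun T >-> E} := HB.pack Y (isMeasurableFun.Build _ _ _ _ _ mY).

Lemma indep_of_measurable_pair : measurable_fun setT (fun w => (Y w, X j w)).
Proof. by apply: measurable_fun_pair. Qed.

(** The left-hand side is a measure in [S], and so is the right-hand side; by
    independence of [Y] from [j |` J] they agree on rectangles. *)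
Let pair_law (J : {fset I}) B S : (forall i, measurable (B i)) ->
    [set` J] `<=` F `\ j -> measurable S ->
  P ((fun w => (Y w, X j w)) @^-1` S `&` cylinder J B) =
    (distribution P Ym \x distribution P (X j)) S * P (cylinder J B).
Proof.
move=> mB JF mS; have mJ := measurable_cylinder J mB.
have jJ : j \notin J by apply/negP => /JF[_ /(_ erefl)].
have JF' : [set` (j |` J)%fset] `<=` F.
  by move=> i /=; rewrite !inE => /orP[/eqP->//|/JF[]].
have kE : (fine (P (cylinder J B)))%:E = P (cylinder J B).
  by rewrite fineK// fin_num_measure.
pose k : {nonneg R} := NngNum (fine_ge0 (measure_ge0 P (cylinder J B))).
pose m' : {measure set (E * R) -> \bar R} :=
  pushforward (mrestr P mJ) (fun w => (Y w, X j w)).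
transitivity (m' indep_of_measurable_pair S) => //.
rewrite -(@product_measure_unique _ _ _ _ _ (distribution P Ym)
  (mscale k (distribution P (X j))))//; last first.
  move=> A B' mA mB' /=.
  rewrite /pushforward /mrestr /mscale /= kE.
  rewrite (_ : _ @^-1` (A `*` B') = Y @^-1` A `&` X j @^-1` B'); last first.
    by apply/seteqP; split.
  rewrite -setIA -cylinderU1// (proj2 YF)//; last exact: measurable_update.
  by rewrite cylinderU1// cylinderU1_prob// [X in _ * X]muleC.
rewrite /product_measure1/= /mscale/= kE.
rewrite ge0_integralZl//.
- by rewrite muleC.
- exact: measurable_fun_xsection.
Qed.

(** Revealing [X j] leaves the other variables independent of what is known.
    This is how the past of a trajectory is built up, one duration at a time. *)
Lemma indep_of_pair : indep_of (fun w => (Y w, X j w)) (F `\ j).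
Proof.
split; first exact: indep_of_measurable_pair.
move=> S J B mS mB JF; rewrite pair_law//; congr (_ * _).
have := @pair_law fset0 (fun=> setT) S (fun=> measurableT) _ mS.
by rewrite cylinder0 setIT probability_setT mule1 => ->.
Qed.

Lemma fresh_integral (nu : probability R R) (f : E * R -> \bar R) :
  (forall A, measurable A -> distribution P (X j) A = nu A) ->
  measurable_fun setT f -> (forall z, 0 <= f z) ->
  \int[P]_w f (Y w, X j w) = \int[P]_w \int[nu]_x f (Y w, x).
Proof.
move=> nuE mf f0.
pose Z : {mfun T >-> (E * R)%type} := HB.pack (fun w => (Y w, X j w))
  (isMeasurableFun.Build _ _ _ _ _ indep_of_measurable_pair).
rewrite -(@ge0_integral_distribution _ _ _ _ _ P Z f)//.
rewrite (@eq_measure_integral _ _ _ _ (distribution P Ym \x nu)); last first.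
  move=> S mS _.
  have := @pair_law fset0 (fun=> setT) S (fun=> measurableT) _ mS.
  rewrite cylinder0 setIT probability_setT mule1 => H.
  rewrite -[LHS]/(P ((fun w => (Y w, X j w)) @^-1` S)) H//.
  by apply: eq_integral => x _; apply: nuE; exact: measurable_xsection.
rewrite fubini_tonelli1//.
rewrite (@ge0_integral_distribution _ _ _ _ _ P Ym)//.
- exact: (measurable_fun_fubini_tonelli_F f).
- by move=> x; apply: integral_ge0.
Qed.

End extension.
End independence.

Section same_mean.
Local Open Scope ereal_scope.
Context d (T : measurableType d) (R : realType) (P : probability T R).
Context dE (E : measurableType dE) (Y : T -> E).
Hypothesis mY : measurable_fun setT Y.
Implicit Types (b q : E -> bool) (U : T -> \bar R) (g : E -> \bar R).

(** [U] is a functional of the whole trajectory and [g] a function of the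
    information [Y] on the past. Measurability of [U] on the event [b] is part of the
    relation, since it is established by the same induction. *)
Definition same_mean_on b U g : Prop :=
  measurable_fun setT (fun w => if b (Y w) then U w else 0) /\
  \int[P]_w (if b (Y w) then U w else 0) =
  \int[P]_w (if b (Y w) then g (Y w) else 0).

Lemma same_mean_ext b U U' g g' :
  (forall w, b (Y w) -> U w = U' w) -> (forall e, b e -> g e = g' e) ->
  same_mean_on b U g -> same_mean_on b U' g'.
Proof.
move=> UU' gg'; rewrite /same_mean_on.
have -> : (fun w => if b (Y w) then U w else 0) =
    (fun w => if b (Y w) then U' w else 0).
  by apply/funext => w; case: ifP => // /UU'.
have -> : (fun w => if b (Y w) then g (Y w) else 0) =
    (fun w => if b (Y w) then g' (Y w) else 0).
  by apply/funext => w; case: ifP => // /gg'.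
by [].
Qed.

Lemma same_mean_add b U g (c : E -> \bar R) :
  measurable_fun setT b -> measurable_fun setT g -> measurable_fun setT c ->
  (forall w, 0 <= U w) -> (forall e, 0 <= g e) -> (forall e, 0 <= c e) ->
  same_mean_on b U g ->
  same_mean_on b (fun w => c (Y w) + U w) (fun e => c e + g e).
Proof.
move=> mb mg mc U0 g0 c0 [mU Ug].
have mcb : measurable_fun setT (fun w => if b (Y w) then c (Y w) else 0).
  by measurability.
have mgb : measurable_fun setT (fun w => if b (Y w) then g (Y w) else 0).
  by measurability.
have cb0 w : 0 <= if b (Y w) then c (Y w) else 0 by case: ifP.
have Ub0 w : 0 <= if b (Y w) then U w else 0 by case: ifP.
have gb0 w : 0 <= if b (Y w) then g (Y w) else 0 by case: ifP.
have E1 : (fun w => if b (Y w) then c (Y w) + U w else 0) =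
    (fun w => (if b (Y w) then c (Y w) else 0) + if b (Y w) then U w else 0).
  by apply/funext => w; case: ifP; rewrite ?adde0.
have E2 : (fun w => if b (Y w) then c (Y w) + g (Y w) else 0) =
    (fun w => (if b (Y w) then c (Y w) else 0) + if b (Y w) then g (Y w) else 0).
  by apply/funext => w; case: ifP; rewrite ?adde0.
rewrite /same_mean_on E1 E2; split; first exact: emeasurable_funD.
by rewrite !ge0_integralD// Ug.
Qed.

Lemma same_mean_split b q U g :
  measurable_fun setT b -> measurable_fun setT q -> measurable_fun setT g ->
  (forall w, 0 <= U w) -> (forall e, 0 <= g e) ->
  same_mean_on (fun e => b e && q e) U g ->
  same_mean_on (fun e => b e && ~~ q e) U g -> same_mean_on b U g.
Proof.
move=> mb mq mg U0 g0 [m1 e1] [m2 e2].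
have E1 : (fun w => if b (Y w) then U w else 0) = (fun w =>
    (if b (Y w) && q (Y w) then U w else 0) +
    (if b (Y w) && ~~ q (Y w) then U w else 0)).
  by apply/funext => w; case: (b _); case: (q _); rewrite /= ?adde0 ?add0e.
have E2 : (fun w => if b (Y w) then g (Y w) else 0) = (fun w =>
    (if b (Y w) && q (Y w) then g (Y w) else 0) +
    (if b (Y w) && ~~ q (Y w) then g (Y w) else 0)).
  by apply/funext => w; case: (b _); case: (q _); rewrite /= ?adde0 ?add0e.
rewrite /same_mean_on E1 E2; split; first exact: emeasurable_funD.
rewrite !ge0_integralD ?e1 ?e2//;
  by [move=> *; case: ifP | measurability].
Qed.

End same_mean.

Section fresh.
Local Open Scope ereal_scope.
Context d (T : measurableType d) (R : realType) (P : probability T R).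
Context (I : choiceType) (X : I -> {mfun T >-> R}).
Hypothesis X_indep : mutually_independent P X.

(** If revealing [X j] makes the mean of [U] computable from [Y] and [X j], then
    averaging over [X j] makes it computable from [Y] alone. *)
Lemma same_mean_fresh dE (E : measurableType dE) (Y : T -> E) F j
    (nu : probability R R) (b : E -> bool) (U : T -> \bar R) (g : E * R -> \bar R) :
  indep_of P X Y F -> F j ->
  (forall A, measurable A -> distribution P (X j) A = nu A) ->
  measurable_fun setT b -> measurable_fun setT g -> (forall z, 0 <= g z) ->
  same_mean_on P (fun w => (Y w, X j w)) (fun z => b z.1) U g ->
  same_mean_on P Y b U (fun e => \int[nu]_x g (e, x)).
Proof.
move=> YF Fj nuE mb mg g0 [mU e]; split => //; rewrite e.
rewrite (fresh_integral X_indep YF Fj nuE (f := fun z => if b z.1 then g z else 0))/=.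
- apply: eq_integral => w _; case: ifP => // _; exact: integral0_eq.
- by measurability.
- by move=> z; case: ifP.
Qed.

End fresh.

(** * The cost of the first events, given the clocks *)

Section clocked_cost.
Local Open Scope ereal_scope.
Context (R : realType) (p : params R) (pi : policy R).
Hypotheses (pi_meas : measurable_policy pi).
Hypotheses (c_so0 : (0 <= c_so p)%R) (c_uso0 : (0 <= c_uso p)%R)
  (c_c0 : (0 <= c_c p)%R).
Variables (nu : condition -> probability R R) (nuU : probability R R).
Variable H : R.

(** The real components of a configuration, as [(now, cond_end, next_so, next_uso)]. *)
Definition clocks : Type := (R * R * R * R)%type.

Definition successor (i : condition) : condition :=
  match i with Perfect => Satisfactory | Satisfactory => Perfect end.

Definition end_cost (i : condition) : R :=
  match i with Perfect => 0%R | Satisfactory => c_c p end.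

Definition replaces (a : action) : bool :=
  match a with Replace => true | DoNothing => false end.

Definition charge (u c : R) : \bar R := if (u <= H)%R then c%:E else 0.

Definition sojourn_first (z : clocks) : bool :=
  (z.1.1.2 <= z.2)%R && (z.1.1.2 <= z.1.2)%R.

Definition uso_first (z : clocks) : bool := (z.2 <= z.1.2)%R.

Definition uso_replaces (i : condition) (z : clocks) : bool :=
  replaces (pi i USO (z.1.2 - z.2)%R).

(** The effect of one event, where the durations that are drawn at this event
    are integrated out. The order of the tests is that of [step]. *)
Definition clock_step (F : condition -> clocks -> \bar R)
    (i : condition) (z : clocks) : \bar R :=
  let ce := z.1.1.2 in let ns := z.1.2 in let nu' := z.2 in
  if sojourn_first z then
    charge ce (end_cost i) +
      \int[nu (successor i)]_x F (successor i) (ce, ce + x, ns, nu')%R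
  else if uso_first z then
    if uso_replaces i z then
      charge nu' (c_uso p) + \int[nuU]_y \int[nu Perfect]_x
        F Perfect (nu', nu' + x, ns, nu' + y)%R
    else \int[nuU]_y F i (nu', ce, ns, nu' + y)%R
  else
    if replaces (pi i SO 0%R) then
      charge ns (c_so p) +
        \int[nu Perfect]_x F Perfect (ns, ns + x, ns + tau p, nu')%R
    else F i (ns, ce, ns + tau p, nu')%R.

Fixpoint clocked_cost (n : nat) : condition -> clocks -> \bar R :=
  if n is m.+1 then clock_step (clocked_cost m) else fun _ _ => 0.

Lemma charge_ge0 u c : (0 <= c)%R -> 0 <= charge u c.
Proof. by move=> c0; rewrite /charge; case: ifP; rewrite ?lee_fin. Qed.

Lemma measurable_charge c : measurable_fun setT (charge ^~ c).
Proof. by rewrite /charge; measurability. Qed.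

Lemma end_cost_ge0 i : (0 <= end_cost i)%R.
Proof. by case: i. Qed.

Lemma clocked_cost_ge0 n i z : 0 <= clocked_cost n i z.
Proof.
elim: n i z => [|n IH] i z //=; rewrite /clock_step.
have I0 (q : probability R R) j (h : R -> clocks) :
    0 <= \int[q]_x clocked_cost n j (h x) by apply: integral_ge0 => x _; exact: IH.
have I1 j (h : R -> R -> clocks) :
    0 <= \int[nuU]_y \int[nu Perfect]_x clocked_cost n j (h y x).
  by apply: integral_ge0 => y _; exact: I0.
case: ifP => _.
  by apply: adde_ge0; [exact/charge_ge0/end_cost_ge0|exact: (I0 _ _ (fun x => _))].
case: ifP => _; case: ifP => _.
- by apply: adde_ge0; [exact: charge_ge0|exact: (I1 _ (fun y x => _))].
- exact: (I0 _ _ (fun x => _)).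
- by apply: adde_ge0; [exact: charge_ge0|exact: (I0 _ _ (fun x => _))].
- exact: IH.
Qed.

Lemma measurable_sojourn_first : measurable_fun setT sojourn_first.
Proof. by rewrite /sojourn_first; measurability. Qed.

Lemma measurable_uso_first : measurable_fun setT uso_first.
Proof. by rewrite /uso_first; measurability. Qed.

Lemma measurable_replaces i o : measurable_fun setT (fun t => replaces (pi i o t)).
Proof.
apply: (measurable_fun_bool true); rewrite setTI.
rewrite (_ : _ @^-1` _ = [set t | pi i o t = Replace]); first exact: pi_meas.
by apply/seteqP; split => t /=; case: (pi i o t).
Qed.

Lemma measurable_uso_replaces i : measurable_fun setT (uso_replaces i).
Proof.
rewrite /uso_replaces; apply: (measurableT_comp (measurable_replaces i USO)).
by measurability.
Qed.

Lemma measurable_integral_comp dE (E : measurableType dE) (q : probability R R)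
    (F : clocks -> \bar R) (f : E * R -> clocks) :
  measurable_fun setT F -> measurable_fun setT f -> (forall z, 0 <= F z) ->
  measurable_fun setT (fun e => \int[q]_x F (f (e, x))).
Proof.
move=> mF mf F0; apply: (measurable_fun_fubini_tonelli_F (F \o f)) => //=.
exact: measurableT_comp.
Qed.

Lemma measurable_clocked_cost n i : measurable_fun setT (clocked_cost n i).
Proof.
elim: n i => [|n IH] i /=; first exact: measurable_cst.
have C0 := clocked_cost_ge0 n.
have mu c := measurable_charge c.
apply: measurable_fun_ifT; first exact: measurable_sojourn_first.
  apply: emeasurable_funD; first by measurability.
  apply: (@measurable_integral_comp _ _ _ _ (fun u : clocks * R =>
    (u.1.1.1.2, u.1.1.1.2 + u.2, u.1.1.2, u.1.2)%R)) => //; by measurability.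
apply: measurable_fun_ifT; first exact: measurable_uso_first.
  apply: measurable_fun_ifT; first exact: measurable_uso_replaces.
    apply: emeasurable_funD; first by measurability.
    apply: (@measurable_fun_fubini_tonelli_F _ _ _ _ _ nuU (fun u : clocks * R =>
      \int[nu Perfect]_x clocked_cost n Perfect
        (u.1.2, u.1.2 + x, u.1.1.2, u.1.2 + u.2)%R)).
    apply: (@measurable_integral_comp _ _ _ _ (fun u : clocks * R * R =>
      (u.1.1.2, u.1.1.2 + u.2, u.1.1.1.2, u.1.1.2 + u.1.2)%R)) => //; by measurability.
    by move=> u; apply: integral_ge0.
  apply: (@measurable_integral_comp _ _ _ _ (fun u : clocks * R =>
    (u.1.2, u.1.1.1.2, u.1.1.2, u.1.2 + u.2)%R)) => //; by measurability.
case: (replaces _).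
  apply: emeasurable_funD; first by measurability.
  apply: (@measurable_integral_comp _ _ _ _ (fun u : clocks * R =>
    (u.1.1.2, u.1.1.2 + u.2, u.1.1.2 + tau p, u.1.2)%R)) => //; by measurability.
by apply: (measurableT_comp (IH i)); measurability.
Qed.

End clocked_cost.

(** * From trajectories to iterated integrals *)

(** Closes the inclusions between sets of unused durations that arise when an
    event reveals a single one of them. *)
Ltac unused_after iF i :=
  let a := fresh "a" in let ua := fresh "ua" in let aE := fresh "aE" in
  move=> [[a|a]|a] ua;
  (split; [apply: iF; move: ua; case: (i) => /= ua; clear - ua; lia
          |move=> [] // aE; move: ua; case: (i) => /= ua; clear - ua aE; lia]).

Section expected_run_cost.
Local Open Scope ereal_scope.
Context (R : realType) (p : params R) (pi : policy R).
Hypotheses (pi_meas : measurable_policy pi).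
Hypotheses (c_so0 : (0 <= c_so p)%R) (c_uso0 : (0 <= c_uso p)%R)
  (c_c0 : (0 <= c_c p)%R).
Context d (T : measurableType d) (P : probability T R).
Variables (life2 life1 gap : nat -> {mfun T >-> R}).
Hypothesis durations : driven_by P p life2 life1 gap.
Variables (nu : condition -> probability R R) (nuU : probability R R).

Definition rate (i : condition) : R :=
  match i with Perfect => mu2 p | Satisfactory => mu1 p end.

Hypothesis nuE : forall i, exp_law (rate i) (nu i).
Hypothesis nuUE : exp_law (lambda p) nuU.
Variable H : R.

Definition duration_index : Type := (nat + nat + nat)%type.

Definition duration (j : duration_index) : {mfun T >-> R} :=
  match j with
  | inl (inl k) => life2 k
  | inl (inr k) => life1 k
  | inr m => gap m
  end.

(** Component [k] uses its second duration only when it becomes satisfactory,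
    hence the distinction between the two states. *)
Definition unused (i : condition) (k m : nat) (j : duration_index) : Prop :=
  match j with
  | inl (inl k') => (k < k')%N
  | inl (inr k') => if i is Perfect then (k <= k')%N else (k < k')%N
  | inr m' => (m < m')%N
  end.

Definition config_of (i : condition) (k m : nat) (z : clocks R) : config R :=
  Config z.1.1.1 i z.1.1.2 z.1.2 z.2 k m.

Let stepw w := step p pi (life2 ^~ w) (life1 ^~ w) (gap ^~ w).

Fixpoint run_cost (n : nat) (s : config R) (w : T) : \bar R :=
  if n is n'.+1 then
    charge H (now (stepw w s).1) (stepw w s).2 + run_cost n' (stepw w s).1 w
  else 0.

Lemma run_cost_ge0 n s w : 0 <= run_cost n s w.
Proof.
elim: n s => //= n IH s; rewrite adde_ge0// charge_ge0// /stepw /step.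
case: ifP => _; first by rewrite /end_sojourn; case: (cond s).
by case: ifP => _; rewrite /unscheduled /scheduled /decide; case: (pi _ _ _).
Qed.

Let mclocked := @measurable_clocked_cost _ p pi pi_meas c_so0 c_uso0 c_c0 nu nuU H.
Let clocked0 := @clocked_cost_ge0 _ p pi c_so0 c_uso0 c_c0 nu nuU H.

Lemma duration_indep : mutually_independent P duration.
Proof. exact: durations_independent durations. Qed.

Lemma life2_law k A : measurable A -> distribution P (life2 k) A = nu Perfect A.
Proof. by move=> mA; rewrite (life2_exponential durations)// nuE. Qed.

Lemma life1_law k A : measurable A ->
  distribution P (life1 k) A = nu Satisfactory A.
Proof. by move=> mA; rewrite (life1_exponential durations)// nuE. Qed.

Lemma gap_law k A : measurable A -> distribution P (gap k) A = nuU A.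
Proof. by move=> mA; rewrite (gap_exponential durations)// nuUE. Qed.

Let same_mean_goal (n : nat) : Prop :=
  forall dE (E : measurableType dE) (Y : T -> E) (F : set duration_index)
    (b : E -> bool) (f : E -> clocks R) i k m,
  indep_of P duration Y F -> unused i k m `<=` F ->
  measurable_fun setT b -> measurable_fun setT f ->
  same_mean_on P Y b (fun w => run_cost n (config_of i k m (f (Y w))) w)
    (fun e => clocked_cost p pi nu nuU H n i (f e)).

Lemma charge0 u : charge H u 0 = 0.
Proof. by rewrite /charge if_same. Qed.

(** The case of an event that draws exactly one duration, [j]. *)
Let advance n dE (E : measurableType dE) (Y : T -> E) (F : set duration_index)
    (b : E -> bool) (f : E -> clocks R) i k m j i' k' m'
    (q : probability R R) (c : E -> \bar R) (f' : E * R -> clocks R) :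
  same_mean_goal n -> indep_of P duration Y F -> F j ->
  (forall A, measurable A -> distribution P (duration j) A = q A) ->
  unused i' k' m' `<=` F `\ j ->
  measurable_fun setT b -> measurable_fun setT c -> (forall e, 0 <= c e) ->
  measurable_fun setT f' ->
  (forall w, b (Y w) ->
    let s := stepw w (config_of i k m (f (Y w))) in
    charge H (now s.1) s.2 = c (Y w) /\
    s.1 = config_of i' k' m' (f' (Y w, duration j w))) ->
  (forall e, b e -> clocked_cost p pi nu nuU H n.+1 i (f e) =
    c e + \int[q]_x clocked_cost p pi nu nuU H n i' (f' (e, x))) ->
  same_mean_on P Y b (fun w => run_cost n.+1 (config_of i k m (f (Y w))) w)
    (fun e => clocked_cost p pi nu nuU H n.+1 i (f e)).
Proof.
move=> IH YF Fj qE uF mb mc c0 mf' stepE clockE.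
have mY := proj1 YF.
have mg := mclocked n i'.
apply: (same_mean_ext (U := fun w => c (Y w) +
    run_cost n (config_of i' k' m' (f' (Y w, duration j w))) w)
  (g := fun e => c e + \int[q]_x clocked_cost p pi nu nuU H n i' (f' (e, x)))).
- by move=> w bw /=; have [-> ->] := stepE _ bw.
- by move=> e be; rewrite clockE.
apply: same_mean_add => //.
- exact: measurable_integral_comp.
- by move=> w; exact: run_cost_ge0.
- by move=> e; apply: integral_ge0.
apply: (same_mean_fresh duration_indep (g := fun z => clocked_cost p pi nu nuU H n i' (f' z))
  YF Fj qE) => //.
- exact: measurableT_comp.
- apply: (IH _ _ _ _ (fun z => b z.1) f' _ _ _ (indep_of_pair duration_indep YF Fj)) => //.
  exact: measurableT_comp.
Qed.

(** The information [Y] on the past is arbitrary in the induction, so that it can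
    grow by the durations that an event reveals. The event [b] confines the
    trajectory to a fixed state and fixed numbers of components and opportunities:
    which durations are unused is then no longer random. *)
Lemma run_cost_same_mean n dE (E : measurableType dE) (Y : T -> E) (F : set duration_index)
    (b : E -> bool) (f : E -> clocks R) i k m :
  indep_of P duration Y F -> unused i k m `<=` F ->
  measurable_fun setT b -> measurable_fun setT f ->
  same_mean_on P Y b (fun w => run_cost n (config_of i k m (f (Y w))) w)
    (fun e => clocked_cost p pi nu nuU H n i (f e)).
Proof.
elim: n dE E Y F b f i k m => [|n IH] dE E Y F b f i k m YF iF mb mf.
  split; last by [].
  by under eq_fun do rewrite if_same; exact: measurable_cst.
have mY := proj1 YF.
have mq1 : measurable_fun setT (fun e => sojourn_first (f e)).
  exact: measurableT_comp (@measurable_sojourn_first R) mf.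
have mq2 : measurable_fun setT (fun e => uso_first (f e)).
  exact: measurableT_comp (@measurable_uso_first R) mf.
have mq3 : measurable_fun setT (fun e => uso_replaces pi i (f e)).
  exact: measurableT_comp (measurable_uso_replaces pi_meas i) mf.
have mg n' i' : measurable_fun setT (fun e => clocked_cost p pi nu nuU H n' i' (f e)).
  exact: measurableT_comp.
have m_charge c := @measurable_charge R H c.
have mf1 : measurable_fun setT (fun e => (f e).1.1.1) by measurability.
have mf2 : measurable_fun setT (fun e => (f e).1.1.2) by measurability.
have mf3 : measurable_fun setT (fun e => (f e).1.2) by measurability.
have mf4 : measurable_fun setT (fun e => (f e).2) by measurability.
have run0 n' i' k' m' w : 0 <= run_cost n' (config_of i' k' m' (f (Y w))) w.
  exact: run_cost_ge0.
have gap_unused : F (inr m.+1) by apply: iF => /=.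
have life2_unused : F (inl (inl k.+1)) by apply: iF => /=.
(* The next event and the action are determined by the known clocks; each case
   is treated separately. *)
apply: (same_mean_split mY (q := fun e => sojourn_first (f e))) => //.
  have mb' : measurable_fun setT (fun e => b e && sojourn_first (f e)).
    by measurability.
  case: i iF mq3 => iF mq3.
    apply: (advance (j := inl (inl k.+1)) (i' := Perfect) (k' := k.+1) (m' := m)
      (q := nu Perfect) (c := fun e => charge H (f e).1.1.2 (c_c p))
      (f' := fun z => ((f z.1).1.1.2, (f z.1).1.1.2 + z.2, (f z.1).1.2, (f z.1).2)%R)
      _ YF) => //.
    - exact: life2_law.
    - by unused_after iF Satisfactory.
    - by measurability.
    - by move=> e; exact: charge_ge0.
    - by measurability.
    - by move=> w /andP[_ soj] /=; rewrite /stepw /step/= -/(sojourn_first (f (Y w))) soj.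
    - by move=> e /andP[_ soj] /=; rewrite /clock_step soj.
  apply: (advance (j := inl (inr k)) (i' := Satisfactory) (k' := k) (m' := m)
    (q := nu Satisfactory) (c := fun e => charge H (f e).1.1.2 0)
    (f' := fun z => ((f z.1).1.1.2, (f z.1).1.1.2 + z.2, (f z.1).1.2, (f z.1).2)%R)
    _ YF) => //.
  - by apply: iF => /=.
  - exact: life1_law.
  - by unused_after iF Perfect.
  - by measurability.
  - by move=> e; exact: charge_ge0.
  - by measurability.
  - by move=> w /andP[_ soj] /=; rewrite /stepw /step/= -/(sojourn_first (f (Y w))) soj.
  - by move=> e /andP[_ soj] /=; rewrite /clock_step soj.
apply: (same_mean_split mY (q := fun e => uso_first (f e))) => //.
- by measurability.
- have mb' : measurable_fun setT
      (fun e => b e && ~~ sojourn_first (f e) && uso_first (f e)).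
    by measurability.
  apply: (same_mean_split mY (q := fun e => uso_replaces pi i (f e))) => //.
  + (* The only event that draws two durations: the next gap and a new life. *)
    have mb'' : measurable_fun setT (fun e => b e && ~~ sojourn_first (f e)
        && uso_first (f e) && uso_replaces pi i (f e)).
      by measurability.
    pose f' (z : E * R * R) : clocks R := ((f z.1.1).2, (f z.1.1).2 + z.2,
      (f z.1.1).1.2, (f z.1.1).2 + z.1.2)%R.
    have mf' : measurable_fun setT f'.
      by rewrite /f'; measurability.
    have mI : measurable_fun setT (fun z : E * R =>
        \int[nu Perfect]_x clocked_cost p pi nu nuU H n Perfect (f' (z, x))).
      by apply: measurable_integral_comp.
    have I0 z : 0 <= \int[nu Perfect]_x clocked_cost p pi nu nuU H n Perfect (f' (z, x)).
      by apply: integral_ge0.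
    apply: (same_mean_ext (U := fun w => charge H (f (Y w)).2 (c_uso p) +
        run_cost n (config_of Perfect k.+1 m.+1
          (f' (Y w, duration (inr m.+1) w, duration (inl (inl k.+1)) w))) w)
      (g := fun e => charge H (f e).2 (c_uso p) + \int[nuU]_y \int[nu Perfect]_x
        clocked_cost p pi nu nuU H n Perfect (f' (e, y, x)))).
    * move=> w /andP[/andP[/andP[_ /negbTE soj] us] rep] /=.
      rewrite /stepw /step/= -/(sojourn_first (f (Y w))) soj.
      rewrite -/(uso_first (f (Y w))) us /unscheduled /=.
      move: rep; rewrite /uso_replaces/=.
      by case: (pi i USO _) => //= _.
    * move=> e /andP[/andP[/andP[_ /negbTE soj] us] rep] /=.
      by rewrite /clock_step soj us rep.
    apply: same_mean_add => //.
    * exact: (measurable_fun_fubini_tonelli_F (fun z => \int[nu Perfect]_x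
        clocked_cost p pi nu nuU H n Perfect (f' (z, x)))).
    * by measurability.
    * by move=> w; exact: run_cost_ge0.
    * by move=> e; apply: integral_ge0.
    * by move=> e; exact: charge_ge0.
    apply: (same_mean_fresh duration_indep (g := fun z => \int[nu Perfect]_x
      clocked_cost p pi nu nuU H n Perfect (f' (z, x))) YF gap_unused) => //.
      exact: gap_law.
    have YF' := indep_of_pair duration_indep YF gap_unused.
    have life2_unused' : (F `\ inr m.+1) (inl (inl k.+1)) by split.
    have mb3 : measurable_fun setT (fun z : E * R => b z.1 && ~~ sojourn_first (f z.1)
        && uso_first (f z.1) && uso_replaces pi i (f z.1)).
      exact: (measurableT_comp mb'' measurable_fst).
    apply: (same_mean_fresh duration_indep (g := fun z =>
      clocked_cost p pi nu nuU H n Perfect (f' z)) YF' life2_unused') => //.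
    * exact: life2_law.
    * exact: measurableT_comp.
    apply: (IH _ _ _ _ (fun z : E * R * R => b z.1.1 && ~~ sojourn_first (f z.1.1)
        && uso_first (f z.1.1) && uso_replaces pi i (f z.1.1)) f' _ _ _
        (indep_of_pair duration_indep YF' life2_unused')) => //.
    * have iF' : unused i k m.+1 `<=` F `\ inr m.+1 by unused_after iF i.
      by unused_after iF' i.
    * exact: (measurableT_comp mb3 measurable_fst).
  + apply: (advance (j := inr m.+1) (i' := i) (k' := k) (m' := m.+1)
      (q := nuU) (c := fun e => 0)
      (f' := fun z => ((f z.1).2, (f z.1).1.1.2, (f z.1).1.2, (f z.1).2 + z.2)%R)
      _ YF) => //.
    * exact: gap_law.
    * by unused_after iF i.
    * by measurability.
    * by measurability.
    * move=> w /andP[/andP[/andP[_ /negbTE soj] us] rep] /=.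
      rewrite /stepw /step/= -/(sojourn_first (f (Y w))) soj.
      rewrite -/(uso_first (f (Y w))) us /unscheduled /=.
      move: rep; rewrite /uso_replaces/=.
      by case: (pi i USO _) => //= _; rewrite charge0.
    * move=> e /andP[/andP[/andP[_ /negbTE soj] us] /negbTE rep] /=.
      by rewrite /clock_step soj us rep add0e.
have mb' : measurable_fun setT
    (fun e => b e && ~~ sojourn_first (f e) && ~~ uso_first (f e)).
  by measurability.
have [rep|rep] := boolP (replaces (pi i SO 0%R)).
  apply: (advance (j := inl (inl k.+1)) (i' := Perfect) (k' := k.+1) (m' := m)
    (q := nu Perfect) (c := fun e => charge H (f e).1.2 (c_so p))
    (f' := fun z => ((f z.1).1.2, (f z.1).1.2 + z.2, (f z.1).1.2 + tau p, (f z.1).2)%R)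
    _ YF) => //.
  - exact: life2_law.
  - by unused_after iF i.
  - by measurability.
  - by move=> e; exact: charge_ge0.
  - by measurability.
  - move=> w /andP[/andP[_ /negbTE soj] /negbTE us] /=.
    rewrite /stepw /step/= -/(sojourn_first (f (Y w))) soj.
    rewrite -/(uso_first (f (Y w))) us /scheduled /=.
    by move: rep; case: (pi i SO _).
  - move=> e /andP[/andP[_ /negbTE soj] /negbTE us] /=.
    by rewrite /clock_step soj us rep.
pose f' e : clocks R := ((f e).1.2, (f e).1.1.2, (f e).1.2 + tau p, (f e).2)%R.
apply: (same_mean_ext (U := fun w => run_cost n (config_of i k m (f' (Y w))) w)
  (g := fun e => clocked_cost p pi nu nuU H n i (f' e))).
- move=> w /andP[/andP[_ /negbTE soj] /negbTE us] /=.
  rewrite /stepw /step/= -/(sojourn_first (f (Y w))) soj.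
  rewrite -/(uso_first (f (Y w))) us /scheduled /=.
  by move: rep; case: (pi i SO _) => //= _; rewrite charge0 add0e.
- move=> e /andP[/andP[_ /negbTE soj] /negbTE us] /=.
  by rewrite /clock_step soj us (negbTE rep).
by apply: IH YF iF _ _ => //; rewrite /f'; measurability.
Qed.

Lemma expected_run_cost n :
  let s0 w := start p (life2 ^~ w) (gap ^~ w) in
  measurable_fun setT (fun w => run_cost n (s0 w) w) /\
  \int[P]_w run_cost n (s0 w) w =
  \int[nu Perfect]_x \int[nuU]_y
    clocked_cost p pi nu nuU H n Perfect (0, x, tau p, y)%R.
Proof.
move=> s0.
have PC (c : \bar R) : \int[P]_w c = c.
  rewrite integral_cst; last exact: measurableT.
  by rewrite [X in c * X](probability_setT P) mule1.
have mT dE (E : measurableType dE) : measurable_fun setT (fun _ : E => true).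
  exact: measurable_cst.
have YF : indep_of P duration (cst tt : T -> unit) setT by exact: indep_of_cst.
have YF1 := indep_of_pair duration_indep YF (j := inl (inl 0%N)) I.
have I2 : ([set: duration_index] `\ inl (inl 0%N)) (inr 0%N) by split.
have YF2 := indep_of_pair duration_indep YF1 I2.
pose f (z : unit * R * R) : clocks R := (0, z.1.2, tau p, z.2)%R.
have mf : measurable_fun setT f by rewrite /f; measurability.
have mg n' i' := @measurable_clocked_cost _ p pi pi_meas c_so0 c_uso0 c_c0 nu nuU H n' i'.
have uF : unused Perfect 0 0 `<=` ([set: duration_index] `\ inl (inl 0%N)) `\ inr 0%N.
  move=> [[a|a]|a] /= ua; (split; [split => // |]); move=> [] // aE;
  by clear - ua aE; lia.
have SM := @run_cost_same_mean n _ _ _ _ (fun=> true) f Perfect 0 0 YF2 uF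
  (mT _ _) mf.
have SM1 := same_mean_fresh duration_indep YF1 I2 (gap_law 0%N)
  (b := fun=> true) (mT _ _) (measurableT_comp (mg n Perfect) mf)
  (fun z => clocked0 _ _ _) SM.
have mI : measurable_fun setT (fun z : unit * R =>
  \int[nuU]_y clocked_cost p pi nu nuU H n Perfect (f (z, y))).
  exact: measurable_integral_comp.
have := same_mean_fresh duration_indep YF (j := inl (inl 0%N)) I (life2_law 0%N)
  (b := fun=> true) (mT _ _) mI
  (fun z => integral_ge0 _ (fun y _ => clocked0 _ _ _)) SM1.
by case=> m1 e1; split; [exact: m1|by rewrite [LHS]e1 -[RHS]PC].
Qed.

End expected_run_cost.

(** * Forgetting the clocks *)

Section mean_cost.
Local Open Scope ereal_scope.
Context (R : realType) (p : params R) (pi : policy R).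
Hypotheses (pi_meas : measurable_policy pi).
Hypotheses (lambda0 : (0 < lambda p)%R) (mu10 : (0 < mu1 p)%R) (mu20 : (0 < mu2 p)%R).
Hypotheses (c_so0 : (0 <= c_so p)%R) (c_uso0 : (0 <= c_uso p)%R)
  (c_c0 : (0 <= c_c p)%R).
Variables (nu : condition -> probability R R) (nuU : probability R R).
Hypothesis nuE : forall i, exp_law (rate p i) (nu i).
Hypothesis nuUE : exp_law (lambda p) nuU.
Variable H : R.
Notation mu := (@lebesgue_measure R).
Notation charge := (charge H).
Notation clocked_cost := (clocked_cost p pi nu nuU H).

(** At time [t], in state [i], with the next scheduled opportunity at [s]. Both
    clocks are taken exponential from [t] on, which is legitimate after every event
    by memorylessness. *)
Definition mean_cost (n : nat) (i : condition) (t s : R) : \bar R :=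
  \int[nu i]_x \int[nuU]_y clocked_cost n i (t, t + x, s, t + y)%R.

Definition mean_cost_at_uso (n : nat) (i : condition) (t s : R) : \bar R :=
  if replaces (pi i USO (s - t)%R) then charge t (c_uso p) + mean_cost n Perfect t s
  else mean_cost n i t s.

Definition mean_cost_at_so (n : nat) (i : condition) (s : R) : \bar R :=
  if replaces (pi i SO 0%R) then
    charge s (c_so p) + mean_cost n Perfect s (s + tau p)%R
  else mean_cost n i s (s + tau p)%R.

Let clocked0 n i z : 0 <= clocked_cost n i z.
Proof. exact: clocked_cost_ge0. Qed.

Let mclocked n i : measurable_fun setT (clocked_cost n i).
Proof. exact: measurable_clocked_cost. Qed.

Lemma rate_gt0 i : (0 < rate p i)%R.
Proof. by case: i. Qed.

Lemma mean_cost_ge0 n i t s : 0 <= mean_cost n i t s.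
Proof. by apply: integral_ge0 => x _; apply: integral_ge0. Qed.

Lemma mean_cost_at_uso_ge0 n i t s : 0 <= mean_cost_at_uso n i t s.
Proof.
rewrite /mean_cost_at_uso; case: ifP => _; last exact: mean_cost_ge0.
by rewrite adde_ge0 ?charge_ge0 ?mean_cost_ge0.
Qed.

Lemma mean_cost_at_so_ge0 n i s : 0 <= mean_cost_at_so n i s.
Proof.
rewrite /mean_cost_at_so; case: ifP => _; last exact: mean_cost_ge0.
by rewrite adde_ge0 ?charge_ge0 ?mean_cost_ge0.
Qed.

Lemma measurable_mean_cost n i s : measurable_fun setT (fun t => mean_cost n i t s).
Proof.
rewrite /mean_cost.
apply: (@measurable_fun_fubini_tonelli_F _ _ _ _ _ (nu i) (fun z : R * R =>
  \int[nuU]_y clocked_cost n i (z.1, z.1 + z.2, s, z.1 + y)%R)) => /=; last first.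
  by move=> z; apply: integral_ge0.
apply: (@measurable_integral_comp R _ _ nuU (clocked_cost n i) (fun u : R * R * R =>
  (u.1.1, u.1.1 + u.1.2, s, u.1.1 + u.2)%R)) => //.
by measurability.
Qed.

Lemma measurable_mean_cost_at_uso n i s :
  measurable_fun setT (fun t => mean_cost_at_uso n i t s).
Proof.
apply: measurable_fun_ifT.
- apply: (measurableT_comp (measurable_replaces pi_meas i USO)).
  by measurability.
- apply: emeasurable_funD; first exact: measurable_charge.
  exact: measurable_mean_cost.
- exact: measurable_mean_cost.
Qed.

Lemma integral_prob_cstD (q : probability R R) (c : \bar R) (f : R -> \bar R) :
  0 <= c -> measurable_fun setT f -> (forall x, 0 <= f x) ->
  \int[q]_x (c + f x) = c + \int[q]_x f x.
Proof.
move=> c0 mf f0; rewrite ge0_integralD//; congr (_ + _).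
rewrite integral_cst; last exact: measurableT.
by rewrite [X in c * X](probability_setT q) mule1.
Qed.

Lemma integral_prob_cst (q : probability R R) (c : \bar R) :
  \int[q]_x c = c.
Proof.
rewrite integral_cst; last exact: measurableT.
by rewrite [X in c * X](probability_setT q) mule1.
Qed.

(** This is [race] with deadline [s - t], the next scheduled opportunity; the
    loser's residual clock is what [mean_cost] integrates over. *)
Lemma mean_costS n i t s : (t <= s)%R ->
  mean_cost n.+1 i t s =
  \int[mu]_(x in `[0%R, (s - t)%R])
    ((expR (- (rate p i + lambda p) * x))%:E *
      ((rate p i)%:E * (charge (t + x) (end_cost p i) +
                        mean_cost n (successor i) (t + x) s) +
       (lambda p)%:E * mean_cost_at_uso n i (t + x) s)) +
  (expR (- (rate p i + lambda p) * (s - t)))%:E * mean_cost_at_so n i s.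
Proof.
move=> ts; set w := (s - t)%R.
pose f (z : R * R) := charge (t + z.1)%R (end_cost p i) +
  \int[nu (successor i)]_u clocked_cost n (successor i)
    (t + z.1, t + z.1 + u, s, t + z.1 + z.2)%R.
pose g (z : R * R) :=
  if replaces (pi i USO (s - (t + z.1))%R) then
    charge (t + z.1)%R (c_uso p) + \int[nuU]_y \int[nu Perfect]_x
      clocked_cost n Perfect (t + z.1, t + z.1 + x, s, t + z.1 + y)%R
  else \int[nuU]_y clocked_cost n i (t + z.1, t + z.1 + z.2, s, t + z.1 + y)%R.
pose h (z : R * R) :=
  if replaces (pi i SO 0%R) then
    charge s (c_so p) + \int[nu Perfect]_x clocked_cost n Perfect
      (s, s + x, s + tau p, s + z.2)%R
  else clocked_cost n i (s, s + z.1, s + tau p, s + z.2)%R.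
have mint dE (E : measurableType dE) (q : probability R R) j (k : E * R -> clocks R) :
    measurable_fun setT k ->
    measurable_fun setT (fun e : E => \int[q]_u clocked_cost n j (k (e, u))).
  move=> mk; exact: (@measurable_integral_comp R _ _ q (clocked_cost n j) k).
have swap j (k : R * R -> clocks R) : measurable_fun setT k ->
    \int[nuU]_y \int[nu j]_u clocked_cost n j (k (y, u)) =
    \int[nu j]_u \int[nuU]_y clocked_cost n j (k (y, u)).
  move=> mk; apply: (@fubini_tonelli _ _ _ _ _ nuU (nu j) (clocked_cost n j \o k)) => //=.
  exact: measurableT_comp.
have mu' := @measurable_charge R H.
have mf : measurable_fun setT f.
  apply: emeasurable_funD; first by measurability.
  apply: (mint _ _ _ _ (fun z : R * R * R => (t + z.1.1, t + z.1.1 + z.2, s, t + z.1.1 + z.1.2)%R)).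
  by measurability.
have mg : measurable_fun setT g.
  apply: measurable_fun_ifT.
  - apply: (measurableT_comp (measurable_replaces pi_meas i USO)).
    by measurability.
  - apply: emeasurable_funD; first by measurability.
    apply: (@measurable_fun_fubini_tonelli_F _ _ _ _ _ nuU (fun z : R * R * R =>
      \int[nu Perfect]_x clocked_cost n Perfect
        (t + z.1.1, t + z.1.1 + x, s, t + z.1.1 + z.2)%R)).
      apply: (mint _ _ _ _ (fun z : R * R * R * R =>
        (t + z.1.1.1, t + z.1.1.1 + z.2, s, t + z.1.1.1 + z.1.2)%R)).
      by measurability.
    by move=> z; exact: integral_ge0.
  - apply: (mint _ _ _ _ (fun z : R * R * R =>
      (t + z.1.1, t + z.1.1 + z.1.2, s, t + z.1.1 + z.2)%R)).
    by measurability.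
have mh : measurable_fun setT h.
  rewrite /h; case: (replaces _); last first.
    by apply: (measurableT_comp (mclocked n i)); measurability.
  apply: emeasurable_funD; first by measurability.
  apply: (mint _ _ _ _ (fun z : R * R * R => (s, s + z.2, s + tau p, s + z.1.2)%R)).
  by measurability.
have int0 (q : probability R R) j (k : R -> clocks R) : 0 <= \int[q]_u clocked_cost n j (k u).
  exact: integral_ge0.
have f0 z : 0 <= f z.
  apply: adde_ge0; first exact/charge_ge0/end_cost_ge0.
  exact: (int0 _ _ (fun u => _)).
have g0 z : 0 <= g z.
  rewrite /g; case: ifP => _; last exact: (int0 _ _ (fun u => _)).
  apply: adde_ge0; first exact: charge_ge0.
  apply: integral_ge0 => y _.
  exact: (int0 _ _ (fun u => _)).
have h0 z : 0 <= h z.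
  rewrite /h; case: ifP => _; last exact: clocked0.
  apply: adde_ge0; first exact: charge_ge0.
  exact: (int0 _ _ (fun u => _)).
have w0 : (0 <= w)%R by rewrite subr_ge0.
transitivity (\int[nu i]_x \int[nuU]_y
    (if (x <= y)%R && (x <= w)%R then f (x, y - x)%R
     else if (y <= w)%R then g (y, x - y)%R else h (x - w, y - w)%R)).
  apply: eq_integral => x _; apply: eq_integral => y _.
  rewrite /= /clock_step /sojourn_first /uso_first /uso_replaces /=.
  rewrite lerD2l -!(lerBrDl _ _ t) -/w /f /g /h /=.
  have -> : (t + x + (y - x) = t + y)%R by ring.
  have -> : (t + y + (x - y) = t + x)%R by ring.
  have -> : (s + (x - w) = t + x)%R by rewrite /w; ring.
  by have -> : (s + (y - w) = t + y)%R by rewrite /w; ring.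
rewrite (race (rate_gt0 i) lambda0 (nuE i) nuUE w0 mf f0 mg g0 mh h0).
congr (_ + _ * _).
- apply: eq_integral => x _; congr (_ * (_ * _ + _ * _)).
  + transitivity (charge (t + x)%R (end_cost p i) + \int[nuU]_y
        \int[nu (successor i)]_u clocked_cost n (successor i)
          (t + x, t + x + u, s, t + x + y)%R); last first.
      congr (_ + _).
      apply: (swap _ (fun z => (t + x, t + x + z.2, s, t + x + z.1)%R)).
      by measurability.
    apply: (@integral_prob_cstD nuU (charge (t + x)%R (end_cost p i)) (fun y =>
      \int[nu (successor i)]_u clocked_cost n (successor i)
          (t + x, t + x + u, s, t + x + y)%R)); first exact/charge_ge0/end_cost_ge0.
    * apply: (mint _ _ _ _ (fun z : R * R => (t + x, t + x + z.2, s, t + x + z.1)%R)).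
      by measurability.
    * by move=> y; exact: (int0 _ _ (fun u => _)).
  + rewrite /g /mean_cost_at_uso /=; case: ifP => _ //.
    rewrite integral_prob_cst; congr (_ + _).
    apply: (swap _ (fun z => (t + x, t + x + z.2, s, t + x + z.1)%R)).
    by measurability.
- rewrite /h /mean_cost_at_so /=; case: (replaces _) => //.
  rewrite integral_prob_cst.
  transitivity (charge s (c_so p) + \int[nuU]_y \int[nu Perfect]_u
      clocked_cost n Perfect (s, s + u, s + tau p, s + y)%R); last first.
    congr (_ + _).
    apply: (swap _ (fun z => (s, s + z.2, s + tau p, s + z.1)%R)).
    by measurability.
  apply: (@integral_prob_cstD nuU (charge s (c_so p)) (fun y => \int[nu Perfect]_u
      clocked_cost n Perfect (s, s + u, s + tau p, s + y)%R)); first exact: charge_ge0.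
  + apply: (mint _ _ _ _ (fun z : R * R => (s, s + z.2, s + tau p, s + z.1)%R)).
    by measurability.
  + by move=> y; exact: (int0 _ _ (fun u => _)).
Qed.

End mean_cost.

(** * Discounted drift *)

Section one_step.
Context {R : realType}.
Notation mu := (@lebesgue_measure R).

Lemma is_derive_continuous (f df : R -> R) :
  (forall x : R, is_derive x 1 f (df x)) -> continuous f.
Proof.
move=> fdf x; apply: differentiable_continuous; apply/derivable1_diffP.
by have [] := fdf x.
Qed.

Lemma is_derive_scale (k x : R) : is_derive x 1 (fun x : R => k * x) k.
Proof.
have -> : (fun x : R => k * x) = k *: (@id R) by [].
by apply: is_derive_eq; exact: mulr1.
Qed.

Lemma is_derive_expR_scale (k x : R) :
  is_derive x 1 (fun x : R => expR (k * x)) (expR (k * x) * k).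
Proof.
exact: (is_derive1_comp (is_derive_expR (k * x)) (is_derive_scale k x)).
Qed.

Section identity.
Variables (b w : R) (f df : R -> R).
Hypotheses (fdf : forall x : R, is_derive x 1 f (df x)) (cdf : continuous df).
Hypothesis w0 : 0 <= w.

Let kappa (x : R) := expR (- b * x) * (b * f x - df x).

Let continuous_kappa : continuous kappa.
Proof.
move=> x; apply: cvgM.
  exact: (is_derive_continuous (is_derive_expR_scale (- b))).
apply: cvgB; last exact: cdf.
by apply: cvgM; [exact: cvg_cst|exact: (is_derive_continuous fdf)].
Qed.

Let is_derive_primitive (x : R) :
  is_derive x 1 (fun x : R => - (expR (- b * x) * f x)) (kappa x).
Proof.
have H := is_deriveN (is_deriveM (is_derive_expR_scale (- b) x) (fdf x)).
apply: (is_derive_eq H); rewrite /kappa /GRing.scale/=; ring.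
Qed.

(** The integrand is the derivative of [- expR (- b * x) * f x]. *)
Lemma integral_discounted_drift :
  (\int[mu]_(x in `[0%R, w]) (expR (- b * x) * (b * f x - df x))%:E =
   (f 0%R - expR (- b * w) * f w)%:E)%E.
Proof.
move: w0; rewrite le_eqVlt => /predU1P[<-|w_gt0].
  by rewrite set_itv1 integral_set1 mulr0 expR0 mul1r subrr.
have cP := is_derive_continuous is_derive_primitive.
rewrite (continuous_FTC2 (F := fun x : R => - (expR (- b * x) * f x)) w_gt0)//.
- by rewrite -EFinB; congr EFin; rewrite mulr0 expR0; ring.
- exact: continuous_subspaceT.
- split.
  + by move=> x _; have [] := is_derive_primitive x.
  + by apply: cvg_at_right_filter; exact: cP.
  + by apply: cvg_at_left_filter; exact: cP.
- by move=> x _; rewrite derive1E; have [_ ->] := is_derive_primitive x.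
Qed.

Variable k : R -> \bar R.
Hypotheses (mk : measurable_fun setT k) (k0 : forall x, (0 <= k x)%E).

Let mkappa : measurable_fun `[0, w] (EFin \o kappa).
Proof.
by apply/measurable_funTS/measurable_EFinP; exact: continuous_measurable_fun.
Qed.

Let mdk : measurable_fun `[0, w] (fun x => ((expR (- b * x))%:E * k x)%E).
Proof.
apply/measurable_funTS/emeasurable_funM => //; apply/measurable_EFinP.
apply: continuous_measurable_fun.
exact: (is_derive_continuous (is_derive_expR_scale (- b))).
Qed.

Let dk0 x : (0 <= (expR (- b * x))%:E * k x)%E.
Proof. by rewrite mule_ge0// lee_fin expR_ge0. Qed.

(** With [b] the total rate of the clocks and [k] the rate at which rewards and
    future costs are collected at the events, [f] is a subsolution of the recursion
    [mean_costS] along a stretch without events. *)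
Lemma discounted_integral_ge :
  (forall x, 0 <= x <= w -> ((b * f x - df x)%:E <= k x)%E) ->
  ((f 0%R)%:E <= \int[mu]_(x in `[0%R, w]) ((expR (- b * x))%:E * k x) +
    (expR (- b * w) * f w)%:E)%E.
Proof.
move=> fk.
have -> : ((f 0%R)%:E = (f 0%R - expR (- b * w) * f w)%:E +
    (expR (- b * w) * f w)%:E)%E by rewrite -EFinD subrK.
rewrite -integral_discounted_drift leeD2r//.
(* the drift may be negative, so that only its positive part is compared *)
rewrite integralE (@le_trans _ _ (\int[mu]_(x in `[0%R, w]) (EFin \o kappa)^\+ x)%E)//.
  by rewrite geeDl// oppe_le0; apply: integral_ge0.
apply: ge0_le_integral => //.
- exact: measurable_funepos.
- move=> x /=; rewrite in_itv/= => xw; rewrite funeposE ge_max dk0 andbT /kappa.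
  by rewrite [X in (X <= _)%E]EFinM lee_wpmul2l ?lee_fin ?expR_ge0// fk.
Qed.

(** The endpoint [0] is excluded: there the remaining time may be a full period
    [tau p], at which the control limit policy does not replace. *)
Lemma discounted_integral_le :
  (forall x, 0 < x <= w -> (k x <= (b * f x - df x)%:E)%E) ->
  (\int[mu]_(x in `[0%R, w]) ((expR (- b * x))%:E * k x) +
    (expR (- b * w) * f w)%:E <= (f 0%R)%:E)%E.
Proof.
move=> fk.
have -> : ((f 0%R)%:E = (f 0%R - expR (- b * w) * f w)%:E +
    (expR (- b * w) * f w)%:E)%E by rewrite -EFinD subrK.
rewrite -integral_discounted_drift leeD2r//.
have oc := @subset_itv_oc_cc _ R 0 w.
rewrite -2?integral_itv_obnd_cbnd; [|exact: measurable_funS mkappa|exact: measurable_funS mdk].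
apply: ge0_le_integral => //; [exact: measurable_funS mdk|exact: measurable_funS mkappa|].
by move=> x /=; rewrite in_itv/= => xw; rewrite EFinM lee_wpmul2l ?lee_fin ?expR_ge0// fk.
Qed.

End identity.
End one_step.

(** * Verification of the optimality equations *)

(** The map that sends [u] to [u / (u + 1)] is nondecreasing. *)
Lemma ler_ratio_succ (R : realFieldType) (a u : R) :
  0 < a -> u <= a -> u <= a / (a + 1) * (u + 1).
Proof.
move=> a0 ua; rewrite mulrAC ler_pdivlMr; last by rewrite ltr_wpDr.
by rewrite !mulrDr !mulr1 (mulrC u) lerD2l.
Qed.

Section verification.
Context (R : realType) (p : params R) (pi : policy R).
Hypotheses (pi_meas : measurable_policy pi).
Hypotheses (tau0 : 0 < tau p) (lambda0 : 0 < lambda p)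
  (mu10 : 0 < mu1 p) (mu20 : 0 < mu2 p).
Hypotheses (c_so0 : 0 <= c_so p) (c_uso0 : 0 <= c_uso p) (c_c0 : 0 <= c_c p).
Variables (nu : condition -> probability R R) (nuU : probability R R).
Hypothesis nuE : forall i, exp_law (rate p i) (nu i).
Hypothesis nuUE : exp_law (lambda p) nuU.
Notation mu := (@lebesgue_measure R).

Variables (V dV : condition -> R -> R) (g M : R).
Hypothesis V_derive : forall i (s : R), is_derive s 1 (V i) (dV i s).
Hypothesis dV_continuous : forall i, continuous (dV i).
Hypothesis g0 : 0 <= g.
Hypothesis V0 : forall i (s : R), 0 <= s <= tau p -> 0 <= V i s.
Hypothesis VM : forall i (s : R), 0 <= s <= tau p -> V i s <= M.

Definition value_at_uso (i : condition) (s : R) : R :=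
  if replaces (pi i USO s) then c_uso p + V Perfect s else V i s.

Definition value_at_so (i : condition) : R :=
  if replaces (pi i SO 0) then c_so p + V Perfect (tau p) else V i (tau p).

Definition generator (i : condition) (s : R) : R :=
  rate p i * (end_cost p i + V (successor i) s - V i s) +
  lambda p * (value_at_uso i s - V i s).

Section path.
Variables (i : condition) (w a b : R).

(** The relative cost along a stretch without events, where the remaining time
    decreases from [w], plus a correction that is affine in the elapsed time. *)
Definition value_path (x : R) : R := V i (w - x) + (a + b * x).
Definition value_path' (x : R) : R := - dV i (w - x) + b.

Let is_derive_sub (x : R) : is_derive x 1 (fun x : R => w - x) (-1).
Proof.
have D := is_deriveB (is_derive_cst w x 1) (is_derive_id x 1).
by apply: (is_derive_eq D); rewrite sub0r.
Qed.

Lemma is_derive_value_path (x : R) :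
  is_derive x 1 value_path (value_path' x).
Proof.
have HV := is_derive1_comp (f := V i) (g := fun x => w - x) (V_derive i (w - x)) (is_derive_sub x).
have Hb := is_deriveD HV (is_deriveD (is_derive_cst a x 1) (is_derive_scale b x)).
by apply: (is_derive_eq Hb); rewrite /value_path' mulrN1 add0r.
Qed.

Lemma continuous_value_path' : continuous value_path'.
Proof.
move=> x; apply: cvgD; last exact: cvg_cst.
apply: cvgN; apply: (@continuous_comp _ _ _ (fun x => w - x) (dV i)).
  exact: (is_derive_continuous is_derive_sub).
exact: dV_continuous.
Qed.

End path.

Section horizon.
Variable H : R.
Hypothesis H0 : 0 <= H.
Notation mean_cost := (mean_cost p pi nu nuU H).

(** The rate at which events at elapsed time [x] contribute to [mean_costS]. *)
Definition event_reward n i t s (x : R) : \bar R :=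
  ((rate p i)%:E * (charge H (t + x) (end_cost p i) +
      mean_cost n (successor i) (t + x)%R s) +
   (lambda p)%:E * mean_cost_at_uso p pi nu nuU H n i (t + x)%R s)%E.

Let rate0 i : 0 < rate p i. Proof. exact: rate_gt0. Qed.

Lemma event_reward_ge0 n i t s x : (0 <= event_reward n i t s x)%E.
Proof.
apply: adde_ge0; apply: mule_ge0; rewrite ?lee_fin ?(ltW (rate0 _)) ?(ltW lambda0)//.
  by apply: adde_ge0; [exact/charge_ge0/end_cost_ge0|exact: mean_cost_ge0].
exact: mean_cost_at_uso_ge0.
Qed.

Lemma measurable_event_reward n i t s :
  measurable_fun setT (event_reward n i t s).
Proof.
have mtx : measurable_fun [set: R] (fun x => t + x) by measurability.
have mr := measurableT_comp (measurable_mean_cost pi_meas c_so0 c_uso0 c_c0 nu nuU H n (successor i) s) mtx.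
have mq := measurableT_comp (measurable_mean_cost_at_uso pi_meas c_so0 c_uso0 c_c0 nu nuU H n i s) mtx.
have mu' := measurableT_comp (@measurable_charge R H (end_cost p i)) mtx.
apply: emeasurable_funD; apply: emeasurable_funM => //; try exact: measurable_cst.
exact: emeasurable_funD.
Qed.

Lemma mean_costSE n i t s : t <= s ->
  (mean_cost n.+1 i t s = \int[mu]_(x in `[0%R, (s - t)%R])
    ((expR (- (rate p i + lambda p) * x))%:E * event_reward n i t s x) +
  (expR (- (rate p i + lambda p) * (s - t)))%:E *
    mean_cost_at_so p pi nu nuU H n i s)%E.
Proof. by move=> ts; rewrite mean_costS. Qed.

Lemma mean_cost_after_horizon n i t s : H < t -> t <= s -> (mean_cost n i t s = 0)%E.
Proof.
elim: n i t s => [|n IH] i t s Ht ts.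
  by apply: integral0_eq => x _; exact: integral0_eq.
have charge0 u c : H < u -> charge H u c = 0%E by rewrite ltNge /charge => /negbTE ->.
have Hs : H < s := lt_le_trans Ht ts.
have stau : s <= s + tau p by rewrite lerDl ltW.
rewrite mean_costSE// integral0_eq; last first.
  move=> x /=; rewrite in_itv/= => /andP[x0 xs].
  have Htx : H < t + x by lra.
  have txs : t + x <= s by lra.
  rewrite /event_reward /mean_cost_at_uso !charge0// !IH//.
  by rewrite !add0e if_same !mule0 adde0 mule0.
by rewrite /mean_cost_at_so charge0// !IH// !add0e if_same mule0.
Qed.

(** At [t <= H] the bound is a supersolution of [mean_costS] by the optimality
    equations; events after [H] cost nothing, so the recursion may be cut at [H]. *)
Lemma mean_cost_le n i t s :
  (forall i s, 0 <= s < tau p -> generator i s <= dV i s + g) ->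
  (forall i, value_at_so i <= V i 0) ->
  t <= H -> t <= s <= t + tau p ->
  (mean_cost n i t s <= (V i (s - t) + g * (H - t))%:E)%E.
Proof.
move=> gen_le so_le.
elim: n i t s => [|n IH] i t s tH /andP[ts st].
  rewrite /mean_cost integral0_eq ?lee_fin; last by move=> x _; exact: integral0_eq.
  by rewrite addr_ge0 ?V0 ?mulr_ge0 ?subr_ge0//; apply/andP; split; lra.
set b := rate p i + lambda p.
pose f := value_path i (s - t) (g * (H - t)) (- g).
pose df := value_path' i (s - t) (- g).
have bpos : 0 < b by rewrite addr_gt0.
have charge_le (u c : R) : 0 <= c -> (charge H u c <= c%:E)%E.
  by move=> c0; rewrite /charge; case: ifP; rewrite ?lee_fin.
have reward_le x : 0 < x <= s - t -> t + x <= H ->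
    (event_reward n i t s x <= (b * f x - df x)%:E)%E.
  move=> /andP[x0 xs] txH.
  have IHx j : (mean_cost n j (t + x)%R s <=
      (V j (s - t - x) + g * (H - (t + x)))%:E)%E.
    have -> : s - t - x = s - (t + x) by ring.
    by apply: IH => //; lra.
  have uso_le : (mean_cost_at_uso p pi nu nuU H n i (t + x)%R s <=
      (value_at_uso i (s - t - x) + g * (H - (t + x)))%:E)%E.
    rewrite /mean_cost_at_uso /value_at_uso.
    have -> : s - (t + x) = s - t - x by ring.
    case: ifP => _; last exact: IHx.
    by rewrite -addrA EFinD leeD// charge_le.
  have soj_le : (charge H (t + x) (end_cost p i) +
      mean_cost n (successor i) (t + x)%R s <=
      (end_cost p i + V (successor i) (s - t - x) + g * (H - (t + x)))%:E)%E.
    by rewrite -addrA EFinD leeD// charge_le ?end_cost_ge0.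
  have r0 : (0 <= (rate p i)%:E)%E by rewrite lee_fin ltW.
  have l0 : (0 <= (lambda p)%:E)%E by rewrite lee_fin ltW.
  apply: (le_trans (leeD (lee_wpmul2l r0 soj_le) (lee_wpmul2l l0 uso_le))).
  rewrite -!EFinM -EFinD lee_fin.
  have := gen_le i (s - t - x); rewrite /generator => /(_ _) G.
  have /G {}G : 0 <= s - t - x < tau p by lra.
  rewrite /f /df /value_path /value_path' /b; lra.
rewrite mean_costSE//; have [sH|Hs] := leP s H.
  have so : (mean_cost_at_so p pi nu nuU H n i s <= (f (s - t))%:E)%E.
    apply: (@le_trans _ _ (value_at_so i + g * (H - s))%:E).
      rewrite /mean_cost_at_so /value_at_so.
      have IHs j : (mean_cost n j s (s + tau p)%R <=
          (V j (tau p) + g * (H - s))%:E)%E.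
        have E : s + tau p - s = tau p by ring.
        rewrite -{2}E.
        by apply: IH => //; lra.
      case: ifP => _; last exact: IHs.
      by rewrite -addrA EFinD leeD// charge_le.
    rewrite lee_fin /f /value_path subrr; have := so_le i; lra.
  have -> : V i (s - t) + g * (H - t) = f 0.
    by rewrite /f /value_path subr0 mulr0 addr0.
  apply: (le_trans _ (@discounted_integral_le _ b (s - t) f df
    (is_derive_value_path i (s - t) (g * (H - t)) (- g))
    (@continuous_value_path' i (s - t) (- g)) _ _
    (measurable_event_reward n i t s) (event_reward_ge0 n i t s) _)).
  - by rewrite leeD2l// EFinM lee_wpmul2l ?lee_fin ?expR_ge0.
  - by rewrite subr_ge0.
  - by move=> x xs; apply: reward_le => //; lra.
have charge0 u c : H < u -> charge H u c = 0%E by rewrite ltNge /charge => /negbTE ->.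
have stau : s <= s + tau p by rewrite lerDl ltW.
have -> : (mean_cost_at_so p pi nu nuU H n i s = 0)%E.
  by rewrite /mean_cost_at_so charge0// !mean_cost_after_horizon// add0e if_same.
rewrite mule0 adde0.
have -> : (\int[mu]_(x in `[0%R, (s - t)%R])
    ((expR (- b * x))%:E * event_reward n i t s x) =
  \int[mu]_(x in `[0%R, (H - t)%R])
    ((expR (- b * x))%:E * event_reward n i t s x))%E.
  rewrite integral_mkcond [RHS]integral_mkcond; apply: eq_integral => x _.
  rewrite !patchE !mem_setE/= !in_itv/=; case: (leP 0 x) => //= x0.
  have [xH|Hx] := leP x (H - t); first by have -> : x <= s - t by lra.
  case: ifP => // xs.
  have Htx : H < t + x by lra.
  have txs : t + x <= s by lra.
  rewrite /event_reward /mean_cost_at_uso !charge0// !mean_cost_after_horizon//.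
  by rewrite !add0e if_same !mule0 adde0 mule0.
have -> : V i (s - t) + g * (H - t) = f 0.
  by rewrite /f /value_path subr0 mulr0 addr0.
apply: (le_trans _ (@discounted_integral_le _ b (H - t) f df
    (is_derive_value_path i (s - t) (g * (H - t)) (- g))
    (@continuous_value_path' i (s - t) (- g)) _ _
    (measurable_event_reward n i t s) (event_reward_ge0 n i t s) _)).
- rewrite leeDl// lee_fin mulr_ge0 ?expR_ge0// /f /value_path.
  have := @V0 i (s - t - (H - t)).
  have -> : s - t - (H - t) = s - H by ring.
  by move=> /(_ _)/le_trans -> //; lra.
- by rewrite subr_ge0.
- by move=> x xs; apply: reward_le => //; lra.
Qed.

(** [b1] dominates the total rate of the clocks in either state. *)
Let b1 := lambda p + mu1 p + mu2 p.
Let g1 := b1 + (tau p)^-1.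
Let u1 := 2 + g1 * H.
Let rho := u1 / (u1 + 1).

(** A bound on the expected number of events up to the horizon: it decreases
    at rate [b1] between events, and at a scheduled opportunity it drops by one, since
    the remaining time jumps from [0] to [tau p]. *)
Definition backlog (t s : R) : R := 2 - (s - t) / tau p + g1 * (H - t).

Let b1_gt0 : 0 < b1. Proof. by rewrite /b1 !addr_gt0. Qed.

Let g1_gt0 : 0 < g1. Proof. by rewrite addr_gt0// invr_gt0. Qed.

Let u1_gt0 : 0 < u1. Proof. by rewrite /u1 ltr_wpDr// mulr_ge0// ltW. Qed.

Lemma backlog_bounds t s : 0 <= t <= H -> t <= s <= t + tau p ->
  1 <= backlog t s <= u1.
Proof.
move=> /andP[t0 tH] /andP[ts st]; rewrite /backlog /u1.
have : 0 <= (s - t) / tau p <= 1.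
  by rewrite divr_ge0 ?subr_ge0 ?(ltW tau0)//= ler_pdivrMr// mul1r; lra.
have : 0 <= g1 * (H - t) <= g1 * H.
  by rewrite mulr_ge0 ?subr_ge0 ?(ltW g1_gt0)//= ler_pM2l//; lra.
lra.
Qed.

Let rho_ge u : u <= u1 -> u <= rho * (u + 1).
Proof. exact: ler_ratio_succ. Qed.

Let rho_ge0 : 0 <= rho.
Proof. by apply: divr_ge0; [exact: ltW|apply: addr_ge0 => //; exact: ltW]. Qed.

(** If the first [n] events all occur before [H], then up to [H] time units are
    left to which the rate [g] has not been applied. The last term accounts for them:
    [rho ^+ n * backlog t s] bounds the probability of this case. *)
Lemma mean_cost_ge n i t s :
  (forall i s, 0 <= s <= tau p -> dV i s + g <= generator i s) ->
  (forall i, V i 0 <= value_at_so i) ->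
  0 <= t <= H -> t <= s <= t + tau p ->
  ((V i (s - t) + g * (H - t) - M - g * H * rho ^+ n * backlog t s)%:E
    <= mean_cost n i t s)%E.
Proof.
move=> gen_ge so_ge.
elim: n i t s => [|n IH] i t s /andP[t0 tH] /andP[ts st].
  apply: (@le_trans _ _ 0%E); last exact: mean_cost_ge0.
  rewrite lee_fin expr0 mulr1.
  have /andP[u0 _] : 1 <= backlog t s <= u1.
    by apply: backlog_bounds; apply/andP.
  have /VM : 0 <= s - t <= tau p by lra.
  move=> /(_ i); have : 0 <= g * H by rewrite mulr_ge0.
  have : 0 <= g * t by rewrite mulr_ge0.
  nra.
set b := rate p i + lambda p.
set K := g * H * rho ^+ n.
have K0 : 0 <= K by rewrite !mulr_ge0// exprn_ge0.
pose u x := backlog (t + x) s.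
pose f := value_path i (s - t)
  (g * (H - t) - M - K * rho * backlog t s) (- g + K * rho * b1).
pose df := value_path' i (s - t) (- g + K * rho * b1).
have bpos : 0 < b by rewrite addr_gt0.
have bb1 : b <= b1 by rewrite /b /b1; case: (i) => /=; have := ltW mu10; have := ltW mu20; lra.
have uE x : backlog (t + x) s = backlog t s - b1 * x.
  by rewrite /backlog /g1; field; rewrite gt_eqF.
have fE x : f x = V i (s - t - x) + g * (H - t - x) - M - K * rho * u x.
  by rewrite /f /value_path /u uE; ring.
have f0E : V i (s - t) + g * (H - t) - M - g * H * rho ^+ n.+1 * backlog t s = f 0.
  by rewrite fE /u addr0 !subr0 exprSr mulrA.
have charge_in x (c : R) : x <= H -> (charge H x c = c%:E)%E by rewrite /charge => ->.
have reward_ge x : 0 <= x <= s - t -> t + x <= H ->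
    ((b * f x - df x)%:E <= event_reward n i t s x)%E.
  move=> /andP[x0 xs] txH.
  have IHx j : ((V j (s - t - x) + g * (H - (t + x)) - M - K * u x)%:E <=
      mean_cost n j (t + x)%R s)%E.
    have -> : s - t - x = s - (t + x) by ring.
    by apply: IH; lra.
  have uso_ge : ((value_at_uso i (s - t - x) + (g * (H - (t + x)) - M - K * u x))%:E
      <= mean_cost_at_uso p pi nu nuU H n i (t + x)%R s)%E.
    rewrite /mean_cost_at_uso /value_at_uso.
    have -> : s - (t + x) = s - t - x by ring.
    case: ifP => _; last by apply: le_trans (IHx i); rewrite !addrA.
    by rewrite charge_in// -addrA EFinD leeD2l//; apply: le_trans (IHx _); rewrite !addrA.
  have soj_ge : ((end_cost p i + V (successor i) (s - t - x) +
      (g * (H - (t + x)) - M - K * u x))%:E <= charge H (t + x) (end_cost p i) +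
      mean_cost n (successor i) (t + x)%R s)%E.
    by rewrite charge_in// -addrA EFinD leeD2l//; apply: le_trans (IHx _); rewrite !addrA.
  have r0 : (0 <= (rate p i)%:E)%E by rewrite lee_fin ltW.
  have l0 : (0 <= (lambda p)%:E)%E by rewrite lee_fin ltW.
  apply: le_trans (leeD (lee_wpmul2l r0 soj_ge) (lee_wpmul2l l0 uso_ge)).
  rewrite -!EFinM -EFinD lee_fin.
  have /gen_ge : 0 <= s - t - x <= tau p by lra.
  move=> /(_ i); rewrite /generator => G.
  have /andP[ux0 ux1] : 1 <= u x <= u1 by apply: backlog_bounds; lra.
  (* the ratio rho absorbs the event that has just been counted *)
  have KP : K * (b * u x) <= K * (rho * (b * u x + b1)).
    apply: ler_wpM2l => //; apply: (@le_trans _ _ (b * (rho * (u x + 1)))).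
      by rewrite ler_wpM2l ?(ltW bpos)// rho_ge.
    rewrite mulrCA; apply: ler_wpM2l => //; lra.
  rewrite fE /df /value_path' /b; rewrite /b in KP; lra.
rewrite f0E mean_costSE//; have [sH|Hs] := leP s H.
  have so : ((f (s - t))%:E <= mean_cost_at_so p pi nu nuU H n i s)%E.
    apply: (@le_trans _ _ (value_at_so i + (g * (H - s) - M -
        K * backlog s (s + tau p)))%:E).
      have uso : backlog s (s + tau p) = 1 + g1 * (H - s).
        by rewrite /backlog; field; rewrite gt_eqF.
      have us : u (s - t) = 2 + g1 * (H - s).
        by rewrite /u /backlog; field; rewrite gt_eqF.
      have /rho_ge R1 : 1 + g1 * (H - s) <= u1.
        have : g1 * (H - s) <= g1 * H by rewrite ler_pM2l//; lra.
        rewrite /u1; lra.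
      have := ler_wpM2l K0 R1; rewrite lee_fin fE subrr uso us.
      have := so_ge i; lra.
    have IHs j : ((V j (tau p) + (g * (H - s) - M - K * backlog s (s + tau p)))%:E <=
        mean_cost n j s (s + tau p)%R)%E.
      have E : s + tau p - s = tau p by ring.
      rewrite -{1}E; apply: (le_trans _ (IH j s (s + tau p) _ _)); rewrite ?lee_fin.
      - by rewrite !addrA.
      - by lra.
      - by lra.
    rewrite /mean_cost_at_so /value_at_so; case: ifP => _; last exact: IHs.
    by rewrite charge_in// -addrA EFinD leeD2l.
  apply: (le_trans (@discounted_integral_ge _ b (s - t) f df
    (is_derive_value_path i (s - t) _ _) (@continuous_value_path' i (s - t) _) _ _
    (measurable_event_reward n i t s) (event_reward_ge0 n i t s) _)).
  - by rewrite subr_ge0.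
  - by move=> x xs; apply: reward_ge => //; lra.
  - by rewrite leeD2l// EFinM lee_wpmul2l ?lee_fin ?expR_ge0.
apply: (le_trans (@discounted_integral_ge _ b (H - t) f df
  (is_derive_value_path i (s - t) _ _) (@continuous_value_path' i (s - t) _) _ _
  (measurable_event_reward n i t s) (event_reward_ge0 n i t s) _)).
- by rewrite subr_ge0.
- by move=> x xs; apply: reward_ge => //; lra.
apply: leeD; last first.
  apply: (@le_trans _ _ 0%E); last first.
    by rewrite mule_ge0 ?lee_fin ?expR_ge0// mean_cost_at_so_ge0.
  rewrite lee_fin pmulr_rle0 ?expR_gt0// fE.
  have /VM : 0 <= s - t - (H - t) <= tau p by lra.
  move=> /(_ i) VMi; rewrite subrr mulr0 addr0.
  have /andP[uH _] : 1 <= u (H - t) <= u1 by apply: backlog_bounds; lra.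
  have : 0 <= K * rho * u (H - t).
    by apply: mulr_ge0; [exact: mulr_ge0|exact: le_trans uH].
  lra.
apply: ge0_subset_integral => //.
- apply/measurable_funTS/emeasurable_funM; last exact: measurable_event_reward.
  apply/measurable_EFinP; apply: continuous_measurable_fun.
  exact: (is_derive_continuous (is_derive_expR_scale (- b))).
- by move=> x _; rewrite mule_ge0 ?lee_fin ?expR_ge0// event_reward_ge0.
- by apply: subset_itvl; rewrite bnd_simp; lra.
Qed.

(** The error term vanishes as [n] grows, because [rho < 1]. *)
Lemma mean_cost_limit_ge i t s (B : \bar R) :
  (forall i s, 0 <= s <= tau p -> dV i s + g <= generator i s) ->
  (forall i, V i 0 <= value_at_so i) ->
  0 <= t <= H -> t <= s <= t + tau p ->
  (forall n, (mean_cost n i t s <= B)%E) ->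
  ((V i (s - t) + g * (H - t) - M)%:E <= B)%E.
Proof.
move=> gen_ge so_ge tH ts redB; set v := V i (s - t) + _ - M.
have rho1 : `|rho| < 1.
  rewrite ger0_norm// /rho ltr_pdivrMr ?mul1r ?ltrDl//.
  by rewrite ltr_wpDr// ltW.
have cv : (v - g * H * rho ^+ n * backlog t s)%:E @[n --> \oo] --> v%:E.
  apply: cvg_EFin; first exact: nearW.
  rewrite -[X in _ --> X]subr0; apply: cvgB; first exact: cvg_cst.
  rewrite -(mul0r (backlog t s)); apply: cvgM; last exact: cvg_cst.
  rewrite -(mulr0 (g * H)); apply: cvgM; first exact: cvg_cst.
  exact: cvg_expr.
rewrite -(cvg_lim _ cv)//; apply: lime_le; first by apply/cvg_ex; exists v%:E.
by apply: nearW => n; apply: le_trans (redB n); exact: mean_cost_ge.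
Qed.

End horizon.
End verification.

(** * The extra cost of a satisfactory component *)

Section glue.
Context {R : realType}.

Definition glue (t : R) (f g : R -> R) (x : R) : R := if x <= t then f x else g x.

Lemma continuous_glue (t : R) (f g : R -> R) : {for t, continuous f} ->
  {for t, continuous g} -> f t = g t -> {for t, continuous (glue t f g)}.
Proof.
move=> cf cg fg; apply/cvgrPdist_lt => e e0.
have gt : glue t f g t = f t by rewrite /glue lexx.
near=> z; rewrite gt /glue; case: ifP => _; last rewrite fg; near: z.
  by move/cvgrPdist_lt : cf; apply.
by move/cvgrPdist_lt : cg; apply.
Unshelve. all: by end_near. Qed.

(** At the joint, the difference quotients of [f] and [g] at [t] extend to
    continuous functions with the same value, so that they can be glued as well. *)
Lemma is_derive_glue (t : R) (f g df dg : R -> R) :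
  (forall x : R, is_derive x 1 f (df x)) -> (forall x : R, is_derive x 1 g (dg x)) ->
  f t = g t -> df t = dg t ->
  forall x : R, is_derive x 1 (glue t f g) (glue t df dg x).
Proof.
move=> fdf gdg fg dfg x; rewrite /glue; case: ltgtP => [xt|tx|->].
- apply: (near_eq_is_derive _ (fdf x)); near=> z.
  by rewrite ifT// ltW//; near: z; exact: lt_nbhsl.
- apply: (near_eq_is_derive _ (gdg x)); near=> z.
  by rewrite leNgt (_ : t < z)//; near: z; exact: lt_nbhsr.
- have /is_derive1_caratheodory[f' [Ef cf f't]] := fdf t.
  have /is_derive1_caratheodory[g' [Eg cg g't]] := gdg t.
  apply/is_derive1_caratheodory; exists (glue t f' g'); split.
  + by move=> z; rewrite lexx /glue; case: ifP => _; rewrite ?Ef// fg Eg.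
  + by apply: continuous_glue => //; rewrite f't g't.
  + by rewrite /glue lexx.
Unshelve. all: by end_near. Qed.

(** The solution of y' = k (e - y) with y(0) = e - c. *)
Definition relax (e k c x : R) : R := e - c * expR (- k * x).

Lemma is_derive_relax (e k c x : R) :
  is_derive x 1 (relax e k c) (k * (e - relax e k c x)).
Proof.
have D := is_deriveB (is_derive_cst e x 1)
  (is_deriveM (is_derive_cst c x 1) (is_derive_expR_scale (- k) x)).
by apply: (is_derive_eq D); rewrite /relax /GRing.scale/= /cst; ring.
Qed.

Lemma relax_le (e k c x : R) : 0 <= c -> relax e k c x <= e.
Proof. by move=> c0; rewrite gerBl mulr_ge0// expR_ge0. Qed.

Lemma relax_homo (e k c : R) : 0 <= k -> 0 <= c ->
  {homo relax e k c : x y / x <= y}.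
Proof.
move=> k0 c0 x y xy; rewrite lerD2l lerN2 ler_wpM2l// ler_expR !mulNr lerN2.
exact: ler_wpM2l.
Qed.

Lemma relax0 (e k c : R) : relax e k c 0 = e - c.
Proof. by rewrite /relax mulr0 expR0 mulr1. Qed.

Lemma is_derive_relax_primitive (e k c x : R) : k != 0 ->
  is_derive x 1 (fun x => k^-1 * (k * e * x - relax e k c x)) (relax e k c x).
Proof.
move=> k0.
have D := is_deriveM (is_derive_cst k^-1 x 1)
  (is_deriveB (is_derive_scale (k * e) x) (is_derive_relax e k c x)).
apply: (is_derive_eq D); rewrite /GRing.scale/= /cst mulr0 addr0.
by field.
Qed.

End glue.

Section wear_cost.
Context (R : realType) (p : params R).
Hypotheses (tau0 : 0 < tau p) (lambda0 : 0 < lambda p)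
  (mu10 : 0 < mu1 p) (mu20 : 0 < mu2 p).
Hypotheses (c_so0 : 0 < c_so p) (c_so_uso : c_so p < c_uso p)
  (c_uso_c : c_uso p < c_c p).

Notation m := (mu1 p + mu2 p).
Notation a := (mu1 p * c_c p).

(** [D] is the extra relative cost of a satisfactory component as a function of
    the remaining time, and [E] a primitive of it, from which the relative cost of a
    perfect component is built. The fields [wear_so] and [wear_uso] say that
    the control limit policy takes the cheaper action at each kind of opportunity. *)
Record wear_cost (D E : R -> R) : Prop := WearCost {
  wear_derive : forall s : R, is_derive s 1 D
    (a - m * D s - lambda p * Num.max 0 (D s - c_uso p));
  wear_primitive : forall s : R, is_derive s 1 E (D s);
  wear_le_so : D 0 <= c_so p;
  wear_le_tau : D 0 <= D (tau p);
  wear_ge0 : forall s, 0 <= s -> 0 <= D s;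
  wear_so : if m * c_so p < a then D 0 = c_so p else D (tau p) = D 0;
  wear_uso : forall s, 0 <= s -> if (m * c_so p < a) && (t_star p <= s%:E)%E
    then c_uso p <= D s else D s <= c_uso p }.

Let m0 : 0 < m. Proof. exact: addr_gt0. Qed.

Let mn0 : m != 0. Proof. by rewrite gt_eqF. Qed.

(** Here [D] never exceeds its limit [a / m], hence never [c_uso p]: the maximum in
    the differential equation vanishes and a single exponential solves it. If [c_so p] is
    above this limit as well, the solution is constant. *)
Lemma wear_cost_below : a <= m * c_uso p -> exists D E, wear_cost D E.
Proof.
move=> am; pose e := a / m; pose c := e - Num.min (c_so p) e.
have me : m * e = a by rewrite /e mulrCA divff// mulr1.
have e0 : 0 < e by rewrite divr_gt0// mulr_gt0// (lt_trans c_so0)// (lt_trans c_so_uso).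
have c0 : 0 <= c by rewrite subr_ge0 ge_min lexx orbT.
have e_uso : e <= c_uso p by rewrite ler_pdivrMr// [leRHS]mulrC.
have D0 : relax e m c 0 = Num.min (c_so p) e by rewrite relax0 opprB addrC subrK.
have Dle s : relax e m c s <= c_uso p := le_trans (relax_le _ _ _ c0) e_uso.
have homo := relax_homo e (ltW m0) c0.
exists (relax e m c), (fun s => m^-1 * (m * e * s - relax e m c s)).
split.
- move=> s; apply: (is_derive_eq (is_derive_relax e m c s)).
  by rewrite max_l ?subr_le0// mulr0 subr0 mulrBr me.
- by move=> s; exact: is_derive_relax_primitive.
- by rewrite D0 ge_min lexx.
- exact/homo/ltW.
- move=> s s0; apply: le_trans (homo _ _ s0); rewrite D0 le_min.
  by rewrite !ltW.
- case: ifP => [so|/negbT]; first by rewrite D0 min_l// ltW// ltr_pdivlMr// mulrC.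
  rewrite -leNgt => so; have es : e <= c_so p by rewrite ler_pdivrMr// [leRHS]mulrC.
  by rewrite /relax /c min_r// subrr !mul0r.
- have am' : (m * c_uso p < a) = false by apply/negbTE; rewrite -leNgt.
  by move=> s s0; rewrite /t_star am' andbF.
Qed.

(** The solution rises from [c_so p] towards [a / m] and reaches [c_uso p] at [t],
    from where on unscheduled replacements slow it down. The time of crossing is [t_star]. *)
Lemma wear_cost_above : m * c_uso p < a -> exists D E, wear_cost D E.
Proof.
move=> am; pose e1 := a / m; pose c1 := e1 - c_so p.
pose k := m + lambda p; pose e2 := (a + lambda p * c_uso p) / k.
have so : m * c_so p < a by apply: lt_trans am; rewrite ltr_pM2l.
have me1 : m * e1 = a by rewrite /e1 mulrCA divff// mulr1.
have k0 : 0 < k by exact: addr_gt0.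
have kn0 : k != 0 by rewrite gt_eqF.
have ke2 : k * e2 = a + lambda p * c_uso p by rewrite /e2 mulrCA divff// mulr1.
have e1_uso : c_uso p < e1 by rewrite ltr_pdivlMr// mulrC.
have e1_so : c_so p < e1 by exact: lt_trans e1_uso.
have e2_uso : c_uso p < e2 by rewrite ltr_pdivlMr// /k; lra.
have c1_gt0 : 0 < c1 by rewrite subr_gt0.
pose t := m^-1 * ln ((m * c_so p - a) / (m * c_uso p - a)).
have ratioE : (m * c_so p - a) / (m * c_uso p - a) = c1 / (e1 - c_uso p).
  have mE x : m * x - a = - m * (e1 - x) by rewrite -me1; ring.
  by rewrite !mE -mulf_div divff ?mul1r// oppr_eq0.
have ratio_gt1 : 1 < c1 / (e1 - c_uso p).
  by rewrite ltr_pdivlMr ?subr_gt0// mul1r /c1 ltrD2l ltrN2.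
have t0 : 0 < t by rewrite /t ratioE mulr_gt0 ?invr_gt0// ln_gt0.
have tE : t_star p = t%:E by rewrite /t_star am max_r// ltW.
have et : c1 * expR (- m * t) = e1 - c_uso p.
  rewrite /t ratioE mulNr mulrA divff// mul1r expRN lnK ?posrE; last first.
    exact: lt_trans ratio_gt1.
  by rewrite invf_div mulrCA divff ?mulr1// gt_eqF.
pose c2 := (e2 - c_uso p) * expR (k * t).
have c20 : 0 < c2 by rewrite mulr_gt0 ?subr_gt0// expR_gt0.
pose D1 := relax e1 m c1; pose D2 := relax e2 k c2.
have D1t : D1 t = c_uso p by rewrite /D1 /relax et; ring.
have D2t : D2 t = c_uso p.
  rewrite /D2 /relax /c2 -mulrA -expRD mulNr subrr expR0; ring.
have homo1 := relax_homo e1 (ltW m0) (ltW c1_gt0) : {homo D1 : x y / x <= y}.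
have homo2 := relax_homo e2 (ltW k0) (ltW c20) : {homo D2 : x y / x <= y}.
pose E1 (s : R) := m^-1 * (m * e1 * s - D1 s).
pose E2 (s : R) := k^-1 * (k * e2 * s - D2 s).
have D10 : D1 0 = c_so p by rewrite /D1 relax0 opprB addrC subrK.
have D0 : glue t D1 D2 0 = c_so p by rewrite /glue ltW.
have Dge s : t <= s -> c_uso p <= glue t D1 D2 s.
  rewrite /glue; case: ltgtP => // [ts|<-] _; last by rewrite D1t.
  by rewrite -D2t homo2// ltW.
have Dle s : s <= t -> glue t D1 D2 s <= c_uso p.
  by move=> st; rewrite /glue st -D1t homo1.
have Dso s : 0 <= s -> c_so p <= glue t D1 D2 s.
  move=> s0; have [st|/ltW ts] := leP s t.
    by rewrite /glue st -D10 homo1.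
  by apply: le_trans (Dge _ ts); exact: ltW.
exists (glue t D1 D2), (glue t E1 (fun s => E2 s + (E1 t - E2 t))).
split.
- move=> s; apply: (is_derive_eq (is_derive_glue (t := t) (is_derive_relax e1 m c1)
    (is_derive_relax e2 k c2) _ _ s)).
  + by rewrite -/D1 -/D2 D1t D2t.
  + by rewrite -/D1 -/D2 D1t D2t !mulrBr me1 ke2 /k; ring.
  rewrite -/D1 -/D2; have [st|/ltW ts] := leP s t.
    have := Dle _ st; rewrite /glue st => Ds.
    by rewrite max_l ?subr_le0// mulr0 subr0 mulrBr me1.
  rewrite max_r ?subr_ge0 ?Dge//; move: ts; rewrite le_eqVlt => /predU1P[<-|ts].
    by rewrite /glue lexx D1t mulrBr me1; ring.
  by rewrite /glue leNgt ts /= mulrBr ke2 /k; ring.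
- move=> s; apply: (is_derive_eq (is_derive_glue (t := t) (f := E1) (df := D1)
    (g := fun s => E2 s + (E1 t - E2 t)) (dg := D2) _ _ _ _ s)) => //.
  + by move=> x; exact: is_derive_relax_primitive.
  + move=> x; have D := is_deriveD (is_derive_relax_primitive e2 c2 x kn0)
      (is_derive_cst (E1 t - E2 t) x 1).
    by apply: (is_derive_eq D); rewrite addr0.
  + by rewrite addrC subrK.
  + by rewrite D1t D2t.
- by rewrite D0.
- by rewrite D0; apply: Dso; exact: ltW.
- by move=> s s0; apply: le_trans (Dso _ s0); exact: ltW.
- by rewrite so D0.
- by move=> s s0; rewrite so tE lee_fin /=; case: leP => [/Dge|/ltW/Dle].
Qed.

Lemma wear_cost_exists : exists D E, wear_cost D E.
Proof.
by have [/wear_cost_below|/wear_cost_above] := leP a (m * c_uso p).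
Qed.

End wear_cost.

(** * From finite horizons to the average cost *)

Section long_run.
Local Open Scope ereal_scope.
Context {R : realType}.

Lemma limf_esup_pinfty_le (f : R -> \bar R) (g M : R) :
  (forall h : R, (0 < h)%R -> f h <= (g + M / h)%:E) ->
  limf_esup f (+oo%R : set_system R) <= g%:E.
Proof.
move=> fle; apply/lee_addgt0Pr => e e0.
pose h0 : R := Num.max 1%R (M / e)%R.
apply: (@le_trans _ _ (ereal_sup (f @` [set h | (h0 < h)%R]))).
  apply: ereal_inf_lbound; exists [set h | (h0 < h)%R] => //.
  exact: nbhs_pinfty_gt (num_real _).
apply: ge_ereal_sup => _ [h /= + <-]; rewrite gt_max => /andP[h1 Mh].
have hpos : (0 < h)%R by apply: lt_trans h1.
apply: le_trans (fle h hpos) _; rewrite -EFinD lee_fin lerD2l.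
by rewrite ler_pdivrMr// mulrC -ler_pdivrMr// ltW.
Qed.

Lemma limf_esup_pinfty_ge (f : R -> \bar R) (g M : R) :
  (forall h : R, (0 < h)%R -> (g - M / h)%:E <= f h) ->
  g%:E <= limf_esup f (+oo%R : set_system R).
Proof.
move=> fge; apply: le_ereal_inf_tmp => _ [A Aoo <-].
apply/lee_addgt0Pr => e e0.
have [h [[h1 Mh] Ah]] : exists h : R, ((1 < h)%R /\ (M / e < h)%R) /\ A h.
  near (pinfty_nbhs R) => h; exists h; split; first split.
  - by near: h; exact: nbhs_pinfty_gt (num_real _).
  - by near: h; exact: nbhs_pinfty_gt (num_real _).
  - by near: h.
have hpos : (0 < h)%R by apply: lt_trans h1.
apply: (@le_trans _ _ ((g - M / h)%:E + e%:E)).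
  rewrite -EFinD lee_fin -addrA lerDl addrC subr_ge0.
  by rewrite ler_pdivrMr// mulrC -ler_pdivrMr// ltW.
by rewrite leeD2r//; apply: le_trans (fge h hpos) _; apply: ereal_sup_ubound; exists h.
Unshelve. all: by end_near. Qed.

End long_run.

Section expected_total_cost.
Local Open Scope ereal_scope.
Context (R : realType) (p : params R) (pi : policy R).
Hypotheses (pi_meas : measurable_policy pi).
Hypotheses (lambda0 : (0 < lambda p)%R) (mu10 : (0 < mu1 p)%R) (mu20 : (0 < mu2 p)%R).
Hypotheses (c_so0 : (0 <= c_so p)%R) (c_uso0 : (0 <= c_uso p)%R)
  (c_c0 : (0 <= c_c p)%R).
Context d (T : measurableType d) (P : probability T R).
Variables (life2 life1 gap : nat -> {mfun T >-> R}).
Hypothesis durations : driven_by P p life2 life1 gap.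

Definition life_distribution (i : condition) : probability R R :=
  match i with
  | Perfect => distribution P (life2 0)
  | Satisfactory => distribution P (life1 0)
  end.

Definition gap_distribution : probability R R := distribution P (gap 0).

Lemma life_distribution_exp i : exp_law (rate p i) (life_distribution i).
Proof.
by case: i => A mA; [exact: life1_exponential durations 0%N A mA
                    |exact: life2_exponential durations 0%N A mA].
Qed.

Lemma gap_distribution_exp : exp_law (lambda p) gap_distribution.
Proof. by move=> A mA; exact: gap_exponential durations 0%N A mA. Qed.

Let total w H := total_cost p pi (life2 ^~ w) (life1 ^~ w) (gap ^~ w) H.
Let run n w H := run_cost p pi life2 life1 gap H n
  (start p (life2 ^~ w) (gap ^~ w)) w.
Let red n H := mean_cost p pi life_distribution gap_distribution H n Perfect 0 (tau p).

Lemma expected_run_costE n H :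
  measurable_fun setT (fun w => run n w H) /\ \int[P]_w run n w H = red n H.
Proof.
have [mrun e] := expected_run_cost pi_meas c_so0 c_uso0 c_c0 durations
  life_distribution_exp gap_distribution_exp H n.
split => //; rewrite [LHS]e; apply: eq_integral => x _; apply: eq_integral => y _.
by rewrite !add0r.
Qed.

Lemma run_cost_series n w H : run n w H =
  \sum_(0 <= k < n) (if (now (after p pi (life2 ^~ w) (life1 ^~ w) (gap ^~ w) k.+1)
      <= H)%R
    then (step p pi (life2 ^~ w) (life1 ^~ w) (gap ^~ w)
      (after p pi (life2 ^~ w) (life1 ^~ w) (gap ^~ w) k)).2%:E else 0).
Proof.
rewrite /run /after; set st := step _ _ _ _ _.
elim: n (start _ _ _) => [|n IH] s; first by rewrite big_geq.
rewrite big_nat_recl//= IH; congr (_ + _); apply: eq_bigr => k _.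
by rewrite -!iterSr.
Qed.

Let event_cost_ge0 w H k :
  0 <= (if (now (after p pi (life2 ^~ w) (life1 ^~ w) (gap ^~ w) k.+1) <= H)%R
    then (step p pi (life2 ^~ w) (life1 ^~ w) (gap ^~ w)
      (after p pi (life2 ^~ w) (life1 ^~ w) (gap ^~ w) k)).2%:E else 0).
Proof.
have := run_cost_ge0 pi c_so0 c_uso0 c_c0 life2 life1 gap H 1
  (after p pi (life2 ^~ w) (life1 ^~ w) (gap ^~ w) k) w.
by rewrite /= adde0.
Qed.

Let run_cvg w H : run n w H @[n --> \oo] --> total w H.
Proof.
under eq_fun do rewrite run_cost_series.
by apply: is_cvg_nneseries => k _ _; exact: event_cost_ge0.
Qed.

Let run_ndecr w H : nondecreasing_seq (fun n => run n w H).
Proof.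
move=> n k nk; rewrite !run_cost_series.
by apply: lee_sum_nneg_natr => // j _ _; exact: event_cost_ge0.
Qed.

Let run_ge0 n w H : 0 <= run n w H.
Proof. exact: run_cost_ge0. Qed.

(** The cost of the first [n] events is nondecreasing in [n]. *)
Lemma expected_total_cost_cvg H :
  red n H @[n --> \oo] --> \int[P]_w total w H.
Proof.
have -> : (fun n => red n H) = fun n => \int[P]_w run n w H.
  by apply/funext => n; rewrite (expected_run_costE n H).2.
rewrite (_ : \int[P]_w total w H = \int[P]_w limn (fun n => run n w H)); last first.
  by apply: eq_integral => w _; apply/esym/cvg_lim => //; exact: run_cvg.
apply: cvg_monotone_convergence => //.
by move=> n; exact: (expected_run_costE n H).1.
Qed.

Lemma expected_total_cost_ge n H : red n H <= \int[P]_w total w H.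
Proof.
rewrite -(expected_run_costE n H).2; apply: ge0_le_integral => //.
- exact: (expected_run_costE n H).1.
- apply: (emeasurable_fun_cvg (fun n w => run n w H)) => [k|w _].
    exact: (expected_run_costE k H).1.
  exact: run_cvg.
- move=> w _; rewrite run_cost_series.
  by apply: nneseries_lim_ge => k _ _; exact: event_cost_ge0.
Qed.

Lemma expected_total_cost_le B H : (forall n, red n H <= B) ->
  \int[P]_w total w H <= B.
Proof.
move=> redB; have /cvg_lim <- // := @expected_total_cost_cvg H.
apply: lime_le; last exact: nearW.
by apply/cvg_ex; exists (\int[P]_w total w H); exact: expected_total_cost_cvg.
Qed.

End expected_total_cost.

(** * Optimality of the control limit policy *)

Section bellman_solution.
Context (R : realType) (p : params R).
Hypotheses (tau0 : 0 < tau p) (lambda0 : 0 < lambda p)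
  (mu10 : 0 < mu1 p) (mu20 : 0 < mu2 p).
Hypotheses (c_so0 : 0 < c_so p) (c_so_uso : c_so p < c_uso p)
  (c_uso_c : c_uso p < c_c p).
Variables (D E : R -> R).
Hypothesis DE : wear_cost p D E.

(** The average of [mu2 p * D s] over a period; this makes [perfect_value]
    periodic. *)
Definition gain : R := mu2 p * (E (tau p) - E 0) / tau p.

(** The relative cost of a perfect component, up to an additive constant. *)
Definition perfect_value (s : R) : R := mu2 p * E s - gain * s.

Variable w0 : R.

(** The constant [w0] will be the minimum of [perfect_value] over a period, which
    makes the relative cost nonnegative. *)
Definition value (i : condition) (s : R) : R :=
  perfect_value s - w0 + (if i is Satisfactory then D s else 0).

Definition value' (i : condition) (s : R) : R :=
  mu2 p * D s - gain + (if i is Satisfactory then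
    mu1 p * c_c p - (mu1 p + mu2 p) * D s - lambda p * Num.max 0 (D s - c_uso p)
    else 0).

Lemma continuous_wear_cost : continuous D.
Proof. exact: is_derive_continuous (wear_derive DE). Qed.

Lemma is_derive_perfect_value (s : R) :
  is_derive s 1 perfect_value (mu2 p * D s - gain).
Proof.
have H := is_deriveB (is_deriveM (is_derive_cst (mu2 p) s 1) (wear_primitive DE s))
  (is_derive_scale gain s).
by apply: (is_derive_eq H); rewrite /GRing.scale/= /cst mulr0 addr0.
Qed.

Lemma perfect_value_tau : perfect_value (tau p) = perfect_value 0.
Proof.
rewrite /perfect_value mulr0 subr0 /gain divfK ?gt_eqF// mulrBr; ring.
Qed.

Lemma is_derive_value i (s : R) : is_derive s 1 (value i) (value' i s).
Proof.
have H1 := is_deriveB (is_derive_perfect_value s) (is_derive_cst w0 s 1).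
case: i; rewrite /value /value'.
  have H := is_deriveD H1 (wear_derive DE s).
  by apply: (is_derive_eq H); rewrite subr0.
have H := is_deriveD H1 (is_derive_cst 0 s 1).
by apply: (is_derive_eq H); rewrite subr0.
Qed.

Lemma continuous_value' i : continuous (value' i).
Proof.
have cD := continuous_wear_cost.
have cl k : continuous (fun s => k * D s).
  by move=> s; apply: cvgM; [exact: cvg_cst|exact: cD].
move=> s; apply: cvgD.
  by apply: cvgB; [exact: cl|exact: cvg_cst].
case: i; last exact: cvg_cst.
apply: cvgB; first by apply: cvgB; [exact: cvg_cst|exact: cl].
apply: cvgM; first exact: cvg_cst.
apply: (@continuous_max R R (cst 0) (fun s => D s - c_uso p)).
  exact: cvg_cst.
by apply: cvgB; [exact: cD|exact: cvg_cst].
Qed.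

Lemma gain_ge0 : 0 <= gain.
Proof.
rewrite /gain divr_ge0 ?(ltW tau0)// mulr_ge0 ?(ltW mu20)// subr_ge0.
have cE := is_derive_continuous (wear_primitive DE).
apply: (@ger0_derive1_ndecr R E 0 (tau p)) => //; last exact: ltW.
- by move=> s _; have [] := wear_primitive DE s.
- move=> s; rewrite in_itv/= => /andP[s0 _]; rewrite derive1E.
  by have [_ ->] := wear_primitive DE s; apply: (wear_ge0 DE); exact: ltW.
- exact: continuous_subspaceT.
Qed.

(** The maximum in the differential equation of [D] is the largest saving that
    any action can achieve at an unscheduled opportunity. *)
Lemma generator_ge (pi : policy R) i s :
  value' i s + gain <= generator p pi value i s.
Proof.
rewrite /generator /value_at_uso /value' /value.
case: i => /=; case: (replaces _).
- have : lambda p * (D s - c_uso p) <= lambda p * Num.max 0 (D s - c_uso p).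
    by rewrite ler_wpM2l ?(ltW lambda0)// le_max lexx orbT.
  lra.
- have : 0 <= lambda p * Num.max 0 (D s - c_uso p).
    by rewrite mulr_ge0 ?(ltW lambda0)// le_max lexx.
  lra.
- have : 0 <= lambda p * c_uso p by rewrite mulr_ge0 ?ltW// (lt_trans c_so0).
  lra.
- lra.
Qed.

(** The control limit policy realises that saving, by [wear_uso]. *)
Lemma generator_le i s : 0 <= s < tau p ->
  generator p (control_limit_policy p) value i s <= value' i s + gain.
Proof.
move=> /andP[s0 st]; rewrite /generator /value_at_uso /value' /value.
case: i => /=; last by lra.
have := wear_uso DE s0; rewrite st andbT; case: ifP => _ /= Ds.
  by rewrite max_r ?subr_ge0//; lra.
by rewrite max_l ?subr_le0//; lra.
Qed.

Lemma value_so_ge (pi : policy R) i : value i 0 <= value_at_so p pi value i.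
Proof.
rewrite /value_at_so /value perfect_value_tau.
have := wear_le_so DE; have := wear_le_tau DE.
have := ltW c_so0; by case: i; case: (replaces _) => /=; lra.
Qed.

Lemma value_so_le i :
  value_at_so p (control_limit_policy p) value i <= value i 0.
Proof.
rewrite /value_at_so /value perfect_value_tau /=; case: i => /=; last by lra.
by have := wear_so DE; case: ifP => _ /= ->; lra.
Qed.

End bellman_solution.

Lemma measurable_control_limit_policy (R : realType) (p : params R) :
  measurable_policy (control_limit_policy p).
Proof.
move=> i o; case: i => /=; last first.
  by rewrite (_ : [set _ | _] = set0)//; apply/seteqP; split.
have [replace|_] := boolP ((mu1 p + mu2 p) * c_so p < mu1 p * c_c p); last first.
  by rewrite (_ : [set _ | _] = set0)//; apply/seteqP; split; case: o.
case: o; first by rewrite (_ : [set _ | _] = setT)//; apply/seteqP; split.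
rewrite (_ : [set _ | _] = (fun t : R => (t_star p <= t%:E)%E) @^-1` [set true] `&`
    [set` `]-oo, tau p[ ]); last first.
  apply/seteqP; split => t /=; rewrite in_itv/=.
    by case: (_ <= _)%E; case: (_ < _).
  by move=> [-> ->].
apply: measurableI => //; rewrite -[X in measurable X]setTI.
by apply: measurable_lee => //; exact: measurable_cst.
Qed.

Theorem theorem2 (R : realType) (p : params R)
    (d : measure_display) (T : measurableType d) (P : probability T R)
    (life2 life1 gap : nat -> {mfun T >-> R})
    (tau_gt0 : 0 < tau p) (lambda_gt0 : 0 < lambda p)
    (mu1_gt0 : 0 < mu1 p) (mu2_gt0 : 0 < mu2 p)
    (c_so_gt0 : 0 < c_so p) (c_so_lt_c_uso : c_so p < c_uso p)
    (c_uso_lt_c_c : c_uso p < c_c p)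
    (durations : driven_by P p life2 life1 gap) :
  optimal P p life2 life1 gap (control_limit_policy p).
Proof.
have [D [E DE]] : exists D E, wear_cost p D E by exact: wear_cost_exists.
have c_so0 := ltW c_so_gt0.
have c_uso0 : 0 <= c_uso p by apply: le_trans (ltW c_so_lt_c_uso).
have c_c0 : 0 <= c_c p by apply: le_trans (ltW c_uso_lt_c_c).
have tau0 := ltW tau_gt0.
have cW := is_derive_continuous (is_derive_perfect_value DE).
(* The relative cost is normalised to be nonnegative, and bounded by [M]. *)
have [w _ wmin] := EVT_min tau0 (continuous_subspaceT cW).
pose V := value p D E (perfect_value p E w); pose dV := value' p D E.
have cV i := is_derive_continuous (is_derive_value DE (perfect_value p E w) i).
have [s2 _ s2max] := EVT_max tau0 (continuous_subspaceT (cV Perfect)).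
have [s1 _ s1max] := EVT_max tau0 (continuous_subspaceT (cV Satisfactory)).
pose M := Num.max (V Perfect s2) (V Satisfactory s1).
have V0 i s : 0 <= s <= tau p -> 0 <= V i s.
  move=> s0t; have := wmin s; rewrite in_itv/= => /(_ s0t) ws.
  have /andP[s0 _] := s0t; have := wear_ge0 DE s0.
  by rewrite /V /value; case: (i); lra.
have VM i s : 0 <= s <= tau p -> V i s <= M.
  move=> s0t; rewrite le_max; case: i.
    by rewrite (s1max s) ?orbT// in_itv.
  by rewrite (s2max s)// in_itv.
have g0 := gain_ge0 tau_gt0 mu2_gt0 DE.
have VD i s := is_derive_value DE (perfect_value p E w) i s.
have cdV i := continuous_value' (i := i) DE.
have mcl := measurable_control_limit_policy p.
have lower pi' : measurable_policy pi' ->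
    ((gain p E)%:E <= average_cost P p life2 life1 gap pi')%E.
  move=> mpi'.
  apply: (limf_esup_pinfty_ge (M := M)) => h h0.
  have hE : gain p E - M / h = h^-1 * (gain p E * h - M) by field; rewrite gt_eqF.
  rewrite hE EFinM lee_wpmul2l// ?lee_fin ?invr_ge0 ?(ltW h0)//.
  apply: (@le_trans _ _ (V Perfect (tau p - 0) + gain p E * (h - 0) - M)%:E).
    by rewrite !subr0 lee_fin -addrA lerDr V0// lexx tau0.
  apply: (mean_cost_limit_ge mpi' tau_gt0 lambda_gt0 mu1_gt0 mu2_gt0 c_so0 c_uso0 c_c0
    (life_distribution_exp durations) (gap_distribution_exp durations) VD cdV g0 VM (ltW h0)).
  - by move=> i s _; exact: generator_ge.
  - by move=> i; exact: value_so_ge.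
  - by rewrite lexx ltW.
  - by rewrite add0r lexx tau0.
  - by move=> n; exact: expected_total_cost_ge.
have upper : (average_cost P p life2 life1 gap (control_limit_policy p)
    <= (gain p E)%:E)%E.
  apply: (limf_esup_pinfty_le (M := M)) => h h0.
  have hE : gain p E + M / h = h^-1 * (M + gain p E * h) by field; rewrite gt_eqF.
  rewrite hE EFinM lee_wpmul2l// ?lee_fin ?invr_ge0 ?(ltW h0)//.
  apply: expected_total_cost_le => //.
  move=> n; apply: (@le_trans _ _ (V Perfect (tau p - 0) + gain p E * (h - 0))%:E).
    apply: (mean_cost_le mcl tau_gt0 lambda_gt0 mu1_gt0 mu2_gt0 c_so0 c_uso0 c_c0
      (life_distribution_exp durations) (gap_distribution_exp durations) VD cdV g0 V0).
    - exact: generator_le.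
    - exact: value_so_le.
    - exact: ltW.
    - by rewrite add0r lexx tau0.
  by rewrite !subr0 lee_fin lerD2r VM// lexx tau0.
split; first exact: mcl.
by move=> pi' mpi'; apply: le_trans upper (lower _ mpi').
Qed.
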